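(* Let $d\ge 1$ and let $\varphi\colon \mathfrak{X}(\mathbb{R}^d)\to\mathfrak{X}(\mathbb{R}^d)$ be a smooth mapping that is local and affine equivariant. Then the Taylor development of $\varphi$ at the zero vector field is an aromatic B-series; that is, there is a function $b\colon \Gamma^1\to\mathbb{R}$ on the set $\Gamma^1$ of aromatic trees such that the Taylor development of $\varphi$ at $0$ is the formal series $$\sum_{m=1}^{\infty}\ \sum_{\gamma\in\Gamma^1,\ |\gamma|=m} b(\gamma)\,\mathcal{F}(\gamma),$$ the inner sum over $|\gamma|=m$ being the homogeneous term of degree $m$.
   Context: $\mathfrak{X}(\mathbb{R}^d)$ is the Fréchet space of smooth vector fields on $\mathbb{R}^d$ (smooth maps $\mathbb{R}^d\to\mathbb{R}^d$, with the $C^\infty$ topology); smoothness of $\varphi$ is in the sense of calculus on Fréchet (convenient) spaces. The Taylor development of $\varphi$ at $0$ is the formal series whose homogeneous term of degree $m$ is $f\mapsto \frac1{m!}D^m\varphi(0)(f,\dots,f)$. Local: $\operatorname{supp}(\varphi(f))\subset\operatorname{supp}(f)$ for all $f$, where $\operatorname{supp}(f)=\overline{\{x: f(x)\ne 0\}}$. Affine equivariant: $\varphi(g\cdot f)=g\cdot\varphi(f)$ for all $f$ and all $g=(\mathsf A,\mathsf b)\in \mathsf{Aff}(d)=\mathsf{GL}(d)\ltimes\mathbb{R}^d$, where $((\mathsf A,\mathsf b)\cdot f)(x)=\mathsf A f(\mathsf A^{-1}(x-\mathsf b))$. An aromatic forest is a finite directed graph (finite node set $N$, finite arrow set $A$,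 source and target maps $s,t\colon A\to N$; loops allowed) with at most one outgoing arrow from each node, i.e. $s$ is injective; graphs are considered up to isomorphism. An aromatic tree is an aromatic forest with $n$ nodes and $n-1$ arrows, for some $n\geq 1$; thus exactly one node, the root $r$, has no outgoing arrow (the graph need not be connected). $|\gamma|$ is the number of nodes of $\gamma$. The elementary differential $\mathcal{F}(\gamma)$ of an aromatic tree $\gamma=(N,A,s,t)$ with root $r$ maps a vector field $f=(f^1,\dots,f^d)$ to the vector field whose component of index $i_r$ is $$\sum_{(i_v)_{v\in N\setminus\{r\}}\in\{1,\dots,d\}^{N\setminus\{r\}}}\ \prod_{v\in N}\Bigl(\prod_{a\in t^{-1}(v)}\frac{\partial}{\partial x_{i_{s(a)}}}\Bigr) f^{i_v}.$$ (Each node $v$ contributes a factor $f^{i_v}$ differentiated in the directions indexed by the nodes pointing to $v$, and all repeated indices are summed.) *)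

(* Defs.v *)
From HB Require Import structures.
From mathcomp Require Import all_boot all_order all_algebra all_fingroup.
From mathcomp Require Import generic_quotient.
From mathcomp Require Import all_classical all_reals all_analysis.

Set Implicit Arguments.
Unset Strict Implicit.
Unset Printing Implicit Defensive.

Import Order.TTheory GRing.Theory Num.Theory.
Import numFieldNormedType.Exports.

Local Open Scope classical_set_scope.
Local Open Scope ring_scope.

Section Smooth.
Context {R : realType} {d : nat}.
Implicit Type W : normedModType R.

Definition pderive W (s : seq 'I_d) (f : 'cV[R]_d -> W) : 'cV[R]_d -> W :=
  foldl (fun g i => 'D_(delta_mx i ord0) g) f s.

(* C^oo: all iterated partial derivatives exist and are (totally)
   differentiable, hence continuous. *)
Definition smooth W (f : 'cV[R]_d -> W) : Prop :=
  forall (s : seq 'I_d) (x : 'cV[R]_d), differentiable (pderive s f) x.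

Lemma smooth_differentiable W (f : 'cV[R]_d -> W) x :
  smooth f -> differentiable f x.
Proof. by move=> /(_ [::] x). Qed.

Lemma smooth_coind W (P : ('cV[R]_d -> W) -> Prop) :
  (forall f, P f -> (forall x, differentiable f x) /\
                    forall i, P ('D_(delta_mx i ord0) f)) ->
  forall f, P f -> smooth f.
Proof.
move=> H f Pf s; elim: s f Pf => [|i s IHs] f Pf x; first exact: (H f Pf).1.
exact: (IHs _ ((H f Pf).2 i)).
Qed.

Lemma smooth_partial W (f : 'cV[R]_d -> W) i :
  smooth f -> smooth ('D_(delta_mx i ord0) f).
Proof. by move=> sf s x; exact: (sf (i :: s) x). Qed.

Lemma smooth_cst W (c : W) : smooth (cst c : 'cV[R]_d -> W).
Proof.
apply: (@smooth_coind _ (fun f => exists c : W, f = cst c)); last by exists c.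
move=> _ [k ->]; split=> [x|i]; first exact: differentiable_cst.
by exists 0; apply/funext => x; rewrite derive_cst.
Qed.

Lemma smooth_lin W (a : R) (f g : 'cV[R]_d -> W) :
  smooth f -> smooth g -> smooth (a *: f + g).
Proof.
move=> sf sg.
apply: (@smooth_coind _ (fun h => exists f g : 'cV[R]_d -> W,
  [/\ smooth f, smooth g & h = a *: f + g])); last by exists f, g.
move=> _ [{sf}f [{sg}g [sf sg ->]]]; split=> [x|i].
  by apply: differentiableD; [apply: differentiableZ|];
    exact: smooth_differentiable.
exists ('D_(delta_mx i ord0) f), ('D_(delta_mx i ord0) g).
split; [exact: smooth_partial|exact: smooth_partial|].
have df x : derivable f x (delta_mx i ord0).
  by apply: diff_derivable; exact: smooth_differentiable.
apply/funext => x; rewrite deriveD ?deriveZ//.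
- exact: derivableZ.
- by apply: diff_derivable; exact: smooth_differentiable.
Qed.

Lemma smoothD W (f g : 'cV[R]_d -> W) :
  smooth f -> smooth g -> smooth (f + g).
Proof. by move=> sf sg; rewrite -[f]scale1r; exact: smooth_lin. Qed.

Lemma smoothZ W (a : R) (f : 'cV[R]_d -> W) : smooth f -> smooth (a *: f).
Proof.
by move=> sf; rewrite -[_ *: _]addr0; apply: smooth_lin => //; exact: smooth_cst.
Qed.

Lemma smooth_sum W (I : Type) (r : seq I) (P : pred I)
    (f : I -> 'cV[R]_d -> W) :
  (forall i, smooth (f i)) -> smooth (\sum_(i <- r | P i) f i).
Proof.
move=> sf; apply: (big_ind (@smooth W)) => //; first exact: smooth_cst.
exact: smoothD.
Qed.

Lemma derive_pderive W (f : 'cV[R]_d -> W) v : smooth f ->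
  'D_v f = \sum_(i < d) v i ord0 *: 'D_(delta_mx i ord0) f.
Proof.
move=> sf; apply/funext => x; have df := smooth_differentiable x sf.
rewrite fct_sumE /= (deriveE v df) [in LHS](matrix_sum_delta v) linear_sum/=.
apply: eq_bigr => i _; rewrite big_ord1 linearZ/=.
by rewrite -(deriveE (delta_mx i ord0) df).
Qed.

Lemma smooth_derive W (f : 'cV[R]_d -> W) v : smooth f -> smooth ('D_v f).
Proof.
move=> sf; rewrite derive_pderive//; apply: smooth_sum => i.
by apply: smoothZ; exact: smooth_partial.
Qed.

Inductive smooth_alg : ('cV[R]_d -> R) -> Prop :=
| SABase f of smooth f : smooth_alg f
| SAAdd f g of smooth_alg f & smooth_alg g : smooth_alg (f + g)
| SAMul f g of smooth_alg f & smooth_alg g : smooth_alg (f * g).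

Lemma smoothM (f g : 'cV[R]_d -> R) : smooth f -> smooth g -> smooth (f * g).
Proof.
move=> sf sg; apply: (@smooth_coind _ smooth_alg); last first.
  by apply: SAMul; exact: SABase.
have dalg h : smooth_alg h -> forall x, differentiable h x.
  elim=> {h} [h sh x|h k _ dh _ dk x|h k _ dh _ dk x].
  - exact: smooth_differentiable.
  - exact: differentiableD.
  - exact: differentiableM.
move=> h ah; split=> [|i]; first exact: dalg.
elim: ah => {h} [h sh|h k ah IHh ak IHk|h k ah IHh ak IHk].
- by apply: SABase; exact: smooth_partial.
- rewrite (_ : 'D__ _ = 'D_(delta_mx i ord0) h + 'D_(delta_mx i ord0) k).
    exact: SAAdd.
  by apply/funext => x; rewrite deriveD//; apply: diff_derivable; exact: dalg.
- rewrite (_ : 'D__ _ = h * 'D_(delta_mx i ord0) k + k * 'D_(delta_mx i ord0) h).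
    by apply: SAAdd; exact: SAMul.
  by apply/funext => x; rewrite deriveM//; apply: diff_derivable; exact: dalg.
Qed.

Lemma smooth_prod (I : Type) (r : seq I) (P : pred I)
    (f : I -> 'cV[R]_d -> R) :
  (forall i, smooth (f i)) -> smooth (\prod_(i <- r | P i) f i).
Proof.
move=> sf; apply: (big_ind (@smooth R)) => //; first exact: smooth_cst.
exact: smoothM.
Qed.

Lemma smooth_coord (n : nat) (f : 'cV[R]_d -> 'cV[R]_n) (j : 'I_n) :
  smooth f -> smooth (fun x => f x j ord0).
Proof.
move=> sf; apply: (@smooth_coind _ (fun h => exists2 f : 'cV[R]_d -> 'cV[R]_n,
  smooth f & h = fun x => f x j ord0)); last by exists f.
move=> _ [{sf}f sf ->]; split=> [x|i].
  apply: (@differentiable_comp _ _ _ _ f (fun M : 'cV[R]_n => M j ord0)).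
    exact: smooth_differentiable.
  exact: differentiable_coord.
exists ('D_(delta_mx i ord0) f); first exact: smooth_partial.
apply/funext => x; rewrite [in RHS]derive_mx ?mxE//.
by apply: diff_derivable; exact: smooth_differentiable.
Qed.

Lemma smooth_col (n : nat) (g : 'I_n -> 'cV[R]_d -> R) :
  (forall j, smooth (g j)) -> smooth (fun x => \col_j g j x).
Proof.
move=> sg; apply: (@smooth_coind _ (fun h => exists2 g : 'I_n -> 'cV[R]_d -> R,
  forall j, smooth (g j) & h = fun x => \col_j g j x)); last by exists g.
move=> _ [{sg}g sg ->].
have dcol x : differentiable (fun x => \col_j g j x) x.
  rewrite (_ : (fun x => _) =
      \sum_(j < n) (fun x => g j x *: (delta_mx j ord0 : 'cV[R]_n))).
    apply: differentiable_sum => j; apply: differentiableZl.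
    exact: smooth_differentiable.
  apply/funext => y; rewrite fct_sumE [LHS]matrix_sum_delta.
  by apply: eq_bigr => j _; rewrite big_ord1 mxE.
split=> // i; exists (fun j => 'D_(delta_mx i ord0) (g j)).
  by move=> j; exact: smooth_partial.
apply/funext => x; rewrite derive_mx; last exact: diff_derivable.
apply/matrixP => j k; rewrite [LHS]mxE [RHS]mxE.
have -> // : (fun y => (\col_j0 g j0 y) j k) = g j.
by apply/funext => y; rewrite mxE.
Qed.

Lemma mulmx_differentiable (m n : nat) (A : 'M[R]_(m, n)) (x : 'cV[R]_n) :
  differentiable (mulmx A : 'cV[R]_n -> 'cV[R]_m) x.
Proof.
rewrite (_ : mulmx A = fun y => \sum_(j < n) (y j ord0 *: col j A)).
  rewrite -fct_sumE; apply: differentiable_sum => j; apply: differentiableZl.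
  exact: differentiable_coord.
apply/funext => y; apply/matrixP => i k; rewrite mxE summxE.
by apply: eq_bigr => j _; rewrite !mxE (ord1 k) mulrC.
Qed.

Lemma mulmx_cvg (m n : nat) (A : 'M[R]_(m, n)) (x : 'cV[R]_n) :
  {for x, continuous (mulmx A : 'cV[R]_n -> 'cV[R]_m)}.
Proof. by apply: differentiable_continuous; exact: mulmx_differentiable. Qed.

Lemma smooth_affine (n : nat) (A : 'M[R]_n) (M : 'M[R]_d) (b : 'cV[R]_d)
    (f : 'cV[R]_d -> 'cV[R]_n) :
  smooth f -> smooth (fun x => A *m f (M *m (x - b))).
Proof.
move=> sf; apply: (@smooth_coind _ (fun h => exists2 f : 'cV[R]_d -> 'cV[R]_n,
  smooth f & h = fun x => A *m f (M *m (x - b)))); last by exists f.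
move=> _ [{sf}f sf ->]; split=> [x|i].
  have dM : differentiable (fun x => M *m (x - b)) x.
    apply: (@differentiable_comp _ _ _ _ (fun x => x - b) (mulmx M)).
      by apply: differentiableB.
    exact: mulmx_differentiable.
  apply: (@differentiable_comp _ _ _ _ (fun x => f (M *m (x - b))) (mulmx A)).
    apply: (@differentiable_comp _ _ _ _ (fun x => M *m (x - b)) f) => //.
    exact: smooth_differentiable.
  exact: mulmx_differentiable.
exists ('D_(M *m delta_mx i ord0) f); first exact: smooth_derive.
apply/funext => x; apply: cvg_lim => //.
rewrite (_ : (fun h => _) = fun h => A *m (h^-1 *:
    ((f \o shift (M *m (x - b))) (h *: (M *m delta_mx i ord0)) -
     f (M *m (x - b))))); last first.
  apply/funext => h /=; rewrite -scalemxAr -mulmxBr; congr (_ *: (_ *m (f _ - _))).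
  by rewrite -addrA mulmxDr scalemxAr.
apply: (@cvg_comp _ _ _ (fun h => h^-1 *:
    ((f \o shift (M *m (x - b))) (h *: (M *m delta_mx i ord0)) -
     f (M *m (x - b)))) (mulmx A)); last exact: mulmx_cvg.
exact/diff_derivable/smooth_differentiable.
Qed.

Definition smooth_pred W : {pred ('cV[R]_d -> W)} := [pred f | `[< smooth f >]].

Lemma smooth_submod_closed W : submod_closed (@smooth_pred W).
Proof.
split=> [|a f g /asboolP sf /asboolP sg]; apply/asboolP; first exact: smooth_cst.
exact: smooth_lin.
Qed.

HB.instance Definition _ W :=
  GRing.isSubmodClosed.Build _ _ (@smooth_pred W) (@smooth_submod_closed W).

End Smooth.

(* The space of smooth vector fields on R^d. *)
Record vfield (R : realType) (d : nat) := VField_def {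
  vfield_fun :> 'cV[R]_d -> 'cV[R]_d ;
  _ : vfield_fun \in @smooth_pred R d 'cV[R]_d }.

Section VField.
Context {R : realType} {d : nat}.
Notation X := (vfield R d).

HB.instance Definition _ := [isSub for @vfield_fun R d].
HB.instance Definition _ := [Choice of X by <:].
HB.instance Definition _ := [SubChoice_isSubLmodule of X by <:].

Definition VField (f : 'cV[R]_d -> 'cV[R]_d) (sf : smooth f) : X :=
  VField_def (introT (asboolP _) sf).

Lemma vfieldP (f : X) : smooth f.
Proof. by apply/asboolP; exact: (valP f). Qed.

(* The C^oo topology: uniform convergence on compact sets of all partial
   derivatives. *)
Definition jet (f : X) :
    {ptws seq 'I_d -> {family compact, 'cV[R]_d -> 'cV[R]_d}} :=
  fun s => pderive s f.

HB.instance Definition _ := isPointed.Build X 0.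
HB.instance Definition _ := Uniform.copy X (initial_topology jet).

Definition diff_quot (phi : X -> X) (f h : X) (t : R) : X :=
  t^-1 *: (phi (f + t *: h) - phi f).

(* [fderive phi [:: h_1; ..; h_m] f] is D^m phi(f)(h_1, .., h_m), the iterated
   directional derivative; it is meaningful when the limits exist. *)
Definition fderive (phi : X -> X) (hs : seq X) : X -> X :=
  foldr (fun h psi f => lim (diff_quot psi f h t @[t --> 0^'])) phi hs.

(* C^oo maps of Frechet spaces (Michal-Bastiani, Hamilton): the iterated
   directional derivatives exist and each D^m phi is jointly continuous in the
   base point and the m directions. Between Frechet spaces this is the same
   class as the smooth maps of convenient calculus. *)
Definition frechet_smooth (phi : X -> X) : Prop :=
  (forall (hs : seq X) (f h : X),
     cvg (diff_quot (fderive phi hs) f h t @[t --> 0^'])) /\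
  (forall m : nat, continuous (fun p : X * {ptws 'I_m -> X} =>
     fderive phi [seq p.2 i | i : 'I_m] p.1)).

(* The homogeneous term of degree m of the Taylor development at 0. *)
Definition taylor_term (phi : X -> X) (m : nat) (f : X) : X :=
  (m`!%:R)^-1 *: fderive phi (nseq m f) 0.

Definition supp (f : X) : set 'cV[R]_d := closure [set x | f x != 0].

Definition local_map (phi : X -> X) : Prop :=
  forall f : X, supp (phi f) `<=` supp f.

Definition aff_act (A : 'M[R]_d) (b : 'cV[R]_d) (f : X) : X :=
  VField (smooth_affine A (invmx A) b (vfieldP f)).

Lemma aff_actE A b (f : X) x : aff_act A b f x = A *m f (invmx A *m (x - b)).
Proof. by []. Qed.

Definition affine_equivariant (phi : X -> X) : Prop :=
  forall (A : 'M[R]_d) (b : 'cV[R]_d), A \in unitmx ->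
  forall f : X, phi (aff_act A b f) = aff_act A b (phi f).

End VField.

(* An aromatic forest on the node set 'I_n and the arrow set 'I_k, given by its
   source and target maps, the source map being injective. Every finite one is
   isomorphic to one of these. *)
Definition forest (n k : nat) : Type :=
  {st : {ffun 'I_k -> 'I_n} * {ffun 'I_k -> 'I_n} | injectiveb st.1}.

HB.instance Definition _ n k := Finite.on (forest n k).

Definition src n k (g : forest n k) : 'I_k -> 'I_n := (val g).1.
Definition tgt n k (g : forest n k) : 'I_k -> 'I_n := (val g).2.

Definition forest_iso n k (g g' : forest n k) : bool :=
  [exists p : {perm 'I_n}, exists q : {perm 'I_k}, forall a,
    (src g' (q a) == p (src g a)) && (tgt g' (q a) == p (tgt g a))].

Lemma forest_isoP n k (g g' : forest n k) :
  reflect (exists (p : {perm 'I_n}) (q : {perm 'I_k}), forall a,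
             src g' (q a) = p (src g a) /\ tgt g' (q a) = p (tgt g a))
          (forest_iso g g').
Proof.
apply: (iffP existsP) => [[p /existsP[q /forallP H]]|[p [q H]]]; exists p.
  by exists q => a; have /andP[/eqP ? /eqP ?] := H a.
by apply/existsP; exists q; apply/forallP => a; have [-> ->] := H a; rewrite !eqxx.
Qed.

Lemma forest_iso_equiv n k : equiv_class_of (@forest_iso n k).
Proof.
split=> [g|g g'|g1 g0 g2].
- by apply/forest_isoP; exists 1%g, 1%g => a; rewrite !perm1.
- suff sym (h h' : forest n k) : forest_iso h h' -> forest_iso h' h.
    by apply/idP/idP; exact: sym.
  move=> /forest_isoP[p [q H]]; apply/forest_isoP; exists p^-1%g, q^-1%g => a.
  have [] := H (q^-1%g a); rewrite permKV => -> ->.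
  by rewrite !permK.
- move=> /forest_isoP[p [q H]] /forest_isoP[p' [q' H']]; apply/forest_isoP.
  exists (p * p')%g, (q * q')%g => a; rewrite !permM.
  by have [-> ->] := H' (q a); have [-> ->] := H a.
Qed.

Canonical forest_iso_equiv_rel n k := EquivRelPack (@forest_iso_equiv n k).

(* Isomorphism classes of aromatic trees with n.+1 nodes and n arrows. *)
Definition atree (n : nat) : Type := {eq_quot (@forest_iso n.+1 n)}%qT.

HB.instance Definition _ n := Quotient.on (atree n).
HB.instance Definition _ n :=
  Finite.copy (atree n) (can_type (@reprK _ (atree n))).

Lemma atreeP n (g g' : forest n.+1 n) :
  reflect (\pi_(atree n)%qT g = \pi_(atree n)%qT g') (forest_iso g g').
Proof.
exact: (@eqmodP _ (forest_iso_equiv_rel n.+1 n) g g').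
Qed.

(* The set Gamma^1 of all aromatic trees. *)
Definition aromatic_tree : Type := {n : nat & atree n}.

(* The root is the unique node without outgoing arrow. *)
Definition root n (g : forest n.+1 n) : 'I_n.+1 :=
  odflt ord0 [pick v | v \notin codom (src g)].

Lemma src_inj n k (g : forest n k) : injective (src g).
Proof. by apply/injectiveP; exact: (valP g). Qed.

Lemma rootP n (g : forest n.+1 n) v :
  (v == root g) = (v \notin codom (src g)).
Proof.
have /cards1P[r Hr] : #|[set v | v \notin codom (src g)]%SET| == 1%N.
  have := cardC (mem (codom (src g))); rewrite card_codom; last exact: src_inj.
  rewrite !card_ord -[RHS]addn1 => /addnI c1; apply/eqP; rewrite cardsE -c1.
  by apply: eq_card => w; rewrite !inE.
have E w : (w \notin codom (src g)) = (w == r).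
  by have := congr1 (fun A : {set 'I_n.+1} => w \in A) Hr; rewrite !inE.
rewrite /root E; case: pickP => [w /=|/(_ r)]; last by rewrite E eqxx.
by rewrite E => /eqP ->.
Qed.

Section ElementaryDifferential.
Context {R : realType} {d : nat}.
Notation X := (vfield R d).

(* The assignment i : N -> {1..d} is summed over with i(root) = j held fixed;
   the order in which the partial derivatives are taken is immaterial. *)
Definition elem_diff_fun n (g : forest n.+1 n) (f : X) (x : 'cV[R]_d) :
    'cV[R]_d :=
  \col_(j < d)
    \sum_(i : {ffun 'I_n.+1 -> 'I_d} | i (root g) == j)
      \prod_(v < n.+1)
        pderive [seq i (src g a) | a <- enum 'I_n & tgt g a == v]
          (fun y => f y (i v) ord0) x.

Lemma smooth_elem_diff n (g : forest n.+1 n) (f : X) :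
  smooth (elem_diff_fun g f).
Proof.
pose h (j : 'I_d) : 'cV[R]_d -> R :=
  \sum_(i : {ffun 'I_n.+1 -> 'I_d} | i (root g) == j) \prod_(v < n.+1)
    pderive [seq i (src g a) | a <- enum 'I_n & tgt g a == v]
      (fun y => f y (i v) ord0).
rewrite (_ : elem_diff_fun g f = fun x => \col_j h j x).
  apply: smooth_col => j; apply: smooth_sum => i; apply: smooth_prod => v.
  have : smooth (fun y => f y (i v) ord0) by apply: smooth_coord; exact: vfieldP.
  by elim: [seq _ | _ <- _] (fun y => _) => //= k s IHs u su;
    apply: IHs; exact: smooth_partial.
apply/funext => x; apply/matrixP => j k; rewrite !mxE /h fct_sumE.
by apply: eq_bigr => i _; rewrite fct_prodE.
Qed.

Definition elem_diff n (g : atree n) (f : X) : X :=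
  VField (smooth_elem_diff (repr g) f).

(* The homogeneous term of degree m of the aromatic B-series with coefficients
   b; an aromatic tree has at least one node, so there is none in degree 0. *)
Definition abseries_term (b : aromatic_tree -> R) (m : nat) (f : X) : X :=
  if m is n.+1 then \sum_(g : atree n) b (Tagged atree g) *: elem_diff g f
  else 0.

End ElementaryDifferential.

(* Main.v *)
Require Import Defs.
From mathcomp Require Import all_boot all_order all_algebra all_fingroup.
From mathcomp Require Import generic_quotient.
From mathcomp Require Import all_classical all_reals all_analysis.
From mathcomp Require Import ring lra.

Set Implicit Arguments.
Unset Strict Implicit.
Unset Printing Implicit Defensive.

Import Order.TTheory GRing.Theory Num.Theory.
Import numFieldNormedType.Exports.

Local Open Scope classical_set_scope.
Local Open Scope ring_scope.

(** Taylor terms of smooth local affine equivariant maps are aromatic.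

    Write T(h_1, .., h_m) for the value at the origin of the m-th derivative
    of phi at the zero field, m = n + 1. It is multilinear, jointly continuous
    for the C^oo topology, and equivariant under GL(d); by translation
    equivariance the values at the other points reduce to this one.

    Taylor terms are differential operators. Let f_mu(x) = f(mu x). Equivariance
    under homotheties gives T(f_mu, .., f_mu) = mu^n T(f, .., f), first for mu
    nonzero, then by continuity for mu = 0. The curve mu |-> f_mu is
    differentiable in the space of vector fields (dilate_cvg), with derivative
    the sum over l of x_l (d_l f)_mu. Differentiating T(f_mu, .., f_mu) n times
    by the Leibniz rule, each derivative picks a slot v and a direction l; at
    mu = 0 the dilated fields become constant. Hence n! T(f, .., f) is the sum,
    over all ways tau of distributing n derivatives among the m slots and all
    directions J, of T applied to the fields
    (prod_{tau a = v} x_{J a}) (d_{J, tau a = v} f)(0)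
    (taylor_form_jets). Thus T(f, .., f) is a universal polynomial in the jet
    of f at 0, homogeneous of total order n.

    Invariant theory. For fixed tau, T on monomial fields is an array of
    coefficients t(K, L) with K and L in {1..d}^m: K gathers the output
    component and the n directions, L the components of the m fields. GL(d)
    equivariance says that t, as an operator on the m-th tensor power, commutes
    with every tensor power of a matrix. By the first fundamental theorem
    (first_fundamental_theorem) t is a combination of permutations s.
    The permutation s contracts the direction of arrow a with the component of
    node s (a + 1) and leaves node s 0 free: with the targets tau this is the
    elementary differential of the aromatic tree with sources s (a + 1),
    targets tau and root s 0 (elem_diff_forest_of_perm).

    The first fundamental theorem is proved from two facts: the operators
    commuting with the symmetric group are spanned by tensor powers
    (polarization), and the span of a finite group of matrices is its own
    double commutant (double_centralizer, an averaging argument).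

    Elementary differentials depend only on the isomorphism class, because
    partial derivatives commute (derive_comm_real, partials_perm), so the
    coefficients may be summed over classes. *)

(** * Double commutant and the first fundamental theorem for GL(d) *)

(** Averaging a projector of the matrix space onto the span U of rho yields a
    projector pr that commutes with left multiplication by rho. Its entries
    pr (delta_mx l k) i j, read as matrices in (i, l), commute with rho, hence
    with t; so pr commutes with left multiplication by t, and
    t = t * pr 1 = pr t lies in U. *)
Lemma double_centralizer (F : numFieldType) (gT : finGroupType) (N : nat)
    (rho : gT -> 'M[F]_N) (t : 'M[F]_N) :
  rho 1%g = 1%:M -> {morph rho : x y / (x * y)%g >-> x *m y} ->
  (forall M, (forall g, rho g *m M = M *m rho g) -> t *m M = M *m t) ->
  exists c : gT -> F, t = \sum_g c g *: rho g.
Proof.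
move=> rho1 rhoM tC.
pose U := (\sum_g <[rho g]>)%VS.
have rhoU g : rho g \in U by apply: (subvP (sumv_sup g _ (subvv _))); rewrite ?memv_line.
have mulU g X : X \in U -> rho g *m X \in U.
  move=> /memv_sumP[vs vsP ->]; rewrite mulmx_sumr; apply: memv_suml => h _.
  have /vlineP[k ->] := vsP h isT.
  by rewrite -scalemxAr -rhoM memvZ.
(* Maschke average of an arbitrary projector onto U. *)
pose pr X := #|gT|%:R^-1 *: \sum_g rho g *m projv U (rho g^-1%g *m X).
have prD : {morph pr : X Y / X + Y}.
  move=> X Y; rewrite /pr -scalerDr -big_split/=; congr (_ *: _).
  by apply: eq_bigr => g _; rewrite mulmxDr linearD mulmxDr.
have prZ a : {morph pr : X / a *: X}.
  move=> X; rewrite /pr [RHS]scalerA [a * _]mulrC -[RHS]scalerA; congr (_ *: _).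
  rewrite scaler_sumr.
  by apply: eq_bigr => g _; rewrite -scalemxAr linearZ -scalemxAr.
have pr0 : pr 0 = 0 by rewrite -[0 in LHS](scale0r 0) prZ scale0r.
have prS (I : finType) (X : I -> 'M[F]_N) : pr (\sum_i X i) = \sum_i pr (X i).
  exact: (big_morph pr prD pr0).
have prU X : pr X \in U.
  by apply: memvZ; apply: memv_suml => g _; apply: mulU; exact: memv_proj.
have cardN0 : #|gT|%:R != 0 :> F by rewrite pnatr_eq0 -lt0n; apply/card_gt0P; exists 1%g.
have pr1 : pr 1%:M = 1%:M.
  rewrite /pr (eq_bigr (fun=> 1%:M)) => [|g _].
    by rewrite sumr_const -[X in _ *: X]scaler_nat scalerA mulVf ?scale1r.
  by rewrite mulmx1 projv_id// -rhoM mulgV.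
have prM g X : pr (rho g *m X) = rho g *m pr X.
  rewrite /pr -scalemxAr mulmx_sumr (reindex_inj (mulgI g)); congr (_ *: _).
  by apply: eq_bigr => h _; rewrite mulmxA -!rhoM invMg mulgKV rhoM mulmxA.
pose M j k : 'M[F]_N := \matrix_(i, l) pr (delta_mx l k) i j.
have ME B j k i l : (M j k *m B) i l = pr (B *m delta_mx l k) i j.
  have -> : B *m delta_mx l k = \sum_p B p l *: delta_mx p k.
    apply/matrixP => x y; rewrite !mxE summxE (bigD1 l)//= big1 => [|z zl].
      rewrite (bigD1 x)//= big1 => [|z zx]; rewrite !mxE ?eqxx ?addr0//.
      by rewrite (negPf (_ : x != z)) ?mulr0// eq_sym.
    by rewrite mxE (negPf zl) mulr0.
  by rewrite prS mxE summxE; apply: eq_bigr => p _; rewrite prZ !mxE mulrC.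
have ME' B j k i l : (B *m M j k) i l = (B *m pr (delta_mx l k)) i j.
  by rewrite !mxE; apply: eq_bigr => p _; rewrite !mxE.
have tM k l : t *m pr (delta_mx l k) = pr (t *m delta_mx l k).
  apply/matrixP => i j; rewrite -ME' -ME tC// => g.
  by apply/matrixP => i' l'; rewrite ME' ME prM.
have tU : t = pr t.
  have e1 : 1%:M = \sum_k delta_mx k k :> 'M[F]_N.
    by rewrite [LHS]matrix_sum_delta; apply: eq_bigr => i _; rewrite (bigD1 i)//= big1 => [|j ji];
      rewrite mxE ?eqxx ?addr0 ?scale1r// eq_sym (negPf ji) scale0r.
  rewrite -[LHS]mulmx1 -pr1 -[t in RHS]mulmx1 e1 mulmx_sumr !prS mulmx_sumr.
  by apply: eq_bigr => k _; exact: tM.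
have /memv_sumP[vs vsP tE] : t \in U by rewrite tU prU.
exists (fun g => projT1 (cid (elimT (vlineP _ _) (vsP g isT)))).
by rewrite tE; apply: eq_bigr => g _; case: cid => /= k ->.
Qed.
(** Inclusion-exclusion over subsets e of the columns: expanding the product
    over rows into maps f, the alternating sum over e kills the maps f that
    miss a column. *)
Lemma polarization (R : numFieldType) (m : nat) (X : 'I_m -> 'I_m -> R) :
  \sum_(e : {ffun 'I_m -> bool})
    (\prod_b (if e b then 1 else -1)) * \prod_a \sum_b (e b)%:R * X a b =
  \sum_(s : {perm 'I_m}) \prod_a X a (s a).
Proof.
under eq_bigr => e _ do rewrite bigA_distr_bigA big_distrr/=.
rewrite exchange_big/= (bigID (fun f : {ffun 'I_m -> 'I_m} => injectiveb f)) /=.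
have E (f : {ffun 'I_m -> 'I_m}) : \sum_(e : {ffun 'I_m -> bool})
    (\prod_b (if e b then 1 else -1)) * \prod_a ((e (f a))%:R * X a (f a)) =
    (\prod_b (b \in codom f)%:R) * \prod_a X a (f a).
  transitivity (\sum_(e : {ffun 'I_m -> bool}) (\prod_b (if e b then 1 else -1)) *
      (\prod_a (e (f a))%:R) * \prod_a X a (f a)).
    by apply: eq_bigr => e _; rewrite -mulrA big_split.
  rewrite -big_distrl/=; congr (_ * _).
  transitivity (\sum_(e : {ffun 'I_m -> bool}) \prod_b
      ((if e b then 1 else -1) * \prod_(a | f a == b) (e b)%:R : R)).
    apply: eq_bigr => e _; rewrite big_split/=; congr (_ * _).
    rewrite (partition_big f predT)//=; apply: eq_bigr => b _.
    by apply: eq_bigr => a /eqP ->.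
  rewrite -(bigA_distr_bigA (fun b (c : bool) =>
    (if c then 1 else -1) * \prod_(a | f a == b) c%:R)).
  apply: eq_bigr => b _.
  rewrite big_bool/= mul1r big1// mulN1r.
  have [/codomP[a ->]|bNf] := boolP (b \in codom f).
    by rewrite (bigD1 a)//= mul0r subr0.
  rewrite big_pred0 ?subrr// => a; apply: contraNF bNf => /eqP <-.
  exact: codom_f.
rewrite [X in _ + X]big1 ?addr0 => [|f nf]; last first.
  rewrite E; have [b bN] : exists b, b \notin codom f.
    apply/existsP; apply: contraR nf => /existsPn fs.
    have /(@image_injP _ _ f predT) fi : #|codom f| == #|'I_m|.
      by apply/eqP/eq_card => b; have := fs b; rewrite negbK => ->.
    by apply/injectiveP => a b; apply: fi.
  by rewrite (bigD1 b)//= (negPf bN) !mul0r.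
rewrite (reindex (@pval _)) /=; last first.
  pose in_Sn := insubd (1%g : {perm 'I_m}).
  by exists in_Sn => /= f Uf; first apply: val_inj; apply: insubdK.
apply: eq_big => /= [s | s _]; first exact: (valP s).
rewrite E big1 ?mul1r => [|b _]; last first.
  suff -> : b \in codom (pval s) by [].
  rewrite -[b](permKV s) pvalE; exact: codom_f.
by apply: eq_bigr => a _; rewrite pvalE.
Qed.

Section TensorInvariants.
Context {F : numFieldType} {m d : nat}.
Notation I := {ffun 'I_m -> 'I_d}.
Implicit Types (K L P : I) (t M : I -> I -> F) (s : {perm 'I_m}) (A : 'M[F]_d).

(** Kernels on multi-indices stand for operators on the m-th tensor power of
    F^d; commutation is stated entrywise, without enumerating the indices. *)
Definition kernel_comm (u t : I -> I -> F) : Prop :=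
  forall K L, \sum_P u K P * t P L = \sum_P t K P * u P L.

Definition tensor_power A K L : F := \prod_a A (K a) (L a).

Lemma kernel_comm_sum (J : finType) (w : J -> F) (u : J -> I -> I -> F) t :
  (forall j, kernel_comm (u j) t) ->
  kernel_comm (fun K L => \sum_j w j * u j K L) t.
Proof.
move=> uC K L; under eq_bigr => P _ do rewrite big_distrl/=.
under [RHS]eq_bigr => P _ do rewrite big_distrr/=.
rewrite exchange_big [RHS]exchange_big; apply: eq_bigr => j _ /=.
under eq_bigr => P _ do rewrite -mulrA.
under [RHS]eq_bigr => P _ do rewrite mulrCA.
by rewrite -!big_distrr uC.
Qed.

Lemma poly_vanish_eq0 (p : {poly F}) : (forall x, p.[x] = 0) -> p = 0.
Proof.
move=> p0; apply/eqP; apply: contraT => pN0.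
have := max_poly_roots pN0 (rs := [seq i%:R | i <- iota 0 (size p)]).
rewrite size_map size_iota ltnn; apply.
  by apply/allP => x _; apply/rootP.
by rewrite map_inj_uniq ?iota_uniq// => i j /eqP; rewrite eqr_nat => /eqP.
Qed.

(** Zariski density: the commutation identity for A + x is polynomial in x and
    holds unless det (A + x) = 0, so its product with the characteristic
    polynomial of - A vanishes identically. *)
Lemma tensor_power_comm t :
  (forall A, A \in unitmx -> kernel_comm (tensor_power A) t) ->
  forall A, kernel_comm (tensor_power A) t.
Proof.
move=> tC A K L.
pose B : 'M[{poly F}]_d := map_mx polyC A + 'X%:M.
pose p := \sum_(P : I) (\prod_a B (K a) (P a)) * (t P L)%:P -
          \sum_(P : I) (t K P)%:P * \prod_a B (P a) (L a).
have pE x : p.[x] = \sum_P tensor_power (A + x%:M) K P * t P L -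
                    \sum_P t K P * tensor_power (A + x%:M) P L.
  have BE K' L' : (\prod_a B (K' a) (L' a)).[x] = tensor_power (A + x%:M) K' L'.
    rewrite horner_prod; apply: eq_bigr => a _; rewrite !mxE !hornerE.
    by rewrite hornerMn hornerX.
  rewrite /p hornerD hornerN !horner_sum; congr (_ - _); apply: eq_bigr => P _;
    by rewrite hornerM hornerC BE.
have : p * char_poly (- A) = 0.
  apply: poly_vanish_eq0 => x; rewrite hornerM pE.
  have [qx|qx] := eqVneq (char_poly (- A)).[x] 0; first by rewrite qx mulr0.
  rewrite tC ?subrr ?mul0r// unitmxE unitfE.
  rewrite (_ : A + x%:M = map_mx (horner_eval x) (char_poly_mx (- A))).
    by rewrite det_map_mx.
  by apply/matrixP => i j; rewrite !mxE/= /horner_eval !hornerE hornerMn hornerX opprK addrC.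
move/eqP; rewrite mulf_eq0 (negPf (monic_neq0 (char_poly_monic _))) orbF.
move=> /eqP p0; have := pE 0; rewrite p0 horner0 => /esym/eqP.
by rewrite subr_eq0 raddf0 addr0 => /eqP.
Qed.

Lemma polarized_power_comm t (E : 'I_m -> 'M[F]_d) :
  (forall A, kernel_comm (tensor_power A) t) ->
  kernel_comm (fun K L => \sum_(s : {perm 'I_m}) \prod_a E (s a) (K a) (L a)) t.
Proof.
move=> tC.
have -> : (fun K L => \sum_(s : {perm 'I_m}) \prod_a E (s a) (K a) (L a)) =
    (fun K L => \sum_(e : {ffun 'I_m -> bool})
       (\prod_b (if e b then 1 else -1)) *
       tensor_power (\sum_b (e b)%:R *: E b) K L).
  apply/funext => K; apply/funext => L.
  rewrite -(polarization (fun a b => E b (K a) (L a))).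
  apply: eq_bigr => e _; congr (_ * _); apply: eq_bigr => a _.
  by rewrite summxE; apply: eq_bigr => b _; rewrite mxE.
by apply: kernel_comm_sum => e; exact: tC.
Qed.

Definition permute K (s : {perm 'I_m}) : I := [ffun a => K (s a)].

Lemma permuteM K s s' : permute (permute K s) s' = permute K (s' * s)%g.
Proof. by apply/ffunP => a; rewrite !ffunE permM. Qed.

Lemma permute1 K : permute K 1%g = K.
Proof. by apply/ffunP => a; rewrite ffunE perm1. Qed.

Lemma permuteK s : cancel (permute^~ s) (permute^~ (s^-1)%g).
Proof. by move=> K; rewrite permuteM mulVg permute1. Qed.

Lemma permuteVK s : cancel (permute^~ (s^-1)%g) (permute^~ s).
Proof. by move=> K; rewrite permuteM mulgV permute1. Qed.

Lemma permute_inj s : injective (permute^~ s).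
Proof. exact: can_inj (permuteK s). Qed.

Lemma prod_eq_ffun K L : \prod_a (K a == L a)%:R = (K == L)%:R :> F.
Proof.
have [->|KL] := eqVneq K L; first by rewrite big1// => a _; rewrite eqxx.
have [a Ka] : exists a, K a != L a.
  by apply/existsP; apply: contraR KL => /existsPn KL; apply/eqP/ffunP => a;
     apply/eqP; have := KL a; rewrite negbK.
by rewrite (bigD1 a)//= (negPf Ka) mul0r.
Qed.

Lemma sum_pred1l (T : finType) (x : T) (f : T -> F) : \sum_y (x == y)%:R * f y = f x.
Proof.
rewrite (bigD1 x)//= eqxx mul1r big1 ?addr0// => y yx.
by rewrite eq_sym (negPf yx) mul0r.
Qed.

Lemma sum_pred1r (T : finType) (x : T) (f : T -> F) : \sum_y f y * (y == x)%:R = f x.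
Proof.
by rewrite -[RHS](sum_pred1l x); apply: eq_bigr => y _; rewrite mulrC eq_sym.
Qed.

(** A kernel invariant under simultaneous permutations is a combination of the
    symmetrized matrix units S k l, which are polarized tensor powers. *)
Lemma symmetric_kernel_comm t M :
  (forall A, kernel_comm (tensor_power A) t) ->
  (forall s K L, M (permute K s) (permute L s) = M K L) -> kernel_comm M t.
Proof.
move=> tC Msym K L.
pose S (k l : I) K L : F := \sum_(s : {perm 'I_m}) (permute k s == K)%:R * (L == permute l s)%:R.
have SC k l : kernel_comm (S k l) t.
  have := @polarized_power_comm t (fun b => delta_mx (k b) (l b)) tC.
  congr (kernel_comm _ _); apply/funext => K'; apply/funext => L'.
  apply: eq_bigr => s _; rewrite -!prod_eq_ffun -big_split/=.
  by apply: eq_bigr => a _; rewrite mxE !ffunE -natrM mulnb eq_sym.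
have mN0 : #|{perm 'I_m}|%:R != 0 :> F.
  by rewrite pnatr_eq0 -lt0n; apply/card_gt0P; exists 1%g.
have ME K' L' : M K' L' =
    \sum_(kl : I * I) (#|{perm 'I_m}|%:R^-1 * M kl.1 kl.2) * S kl.1 kl.2 K' L'.
  under eq_bigr => kl _ do rewrite big_distrr/=.
  rewrite exchange_big/= (eq_bigr (fun=> #|{perm 'I_m}|%:R^-1 * M K' L')).
    by rewrite sumr_const -[RHS]mulr_natl mulrA divff ?mul1r.
  move=> s _.
  rewrite -(pair_bigA _ (fun k l => #|{perm 'I_m}|%:R^-1 * M k l *
     ((permute k s == K')%:R * (L' == permute l s)%:R)))/=.
  rewrite (eq_bigr (fun k => (#|{perm 'I_m}|%:R^-1 * M k (permute L' s^-1%g)) *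
      (k == permute K' s^-1%g)%:R)).
    by rewrite sum_pred1r Msym.
  move=> k _; rewrite -(sum_pred1r (permute L' s^-1%g) (fun l => _ * M k l)) big_distrl/=.
  apply: eq_bigr => l _; rewrite -!mulrA; congr (_ * (_ * _)); rewrite mulrC.
  rewrite -[l == _](inj_eq (@permute_inj s)) -[k == _](inj_eq (@permute_inj s)).
  by rewrite !permuteVK [L' == _]eq_sym.
have -> : M = (fun K L =>
    \sum_(kl : I * I) (#|{perm 'I_m}|%:R^-1 * M kl.1 kl.2) * S kl.1 kl.2 K L).
  by apply/funext => ?; apply/funext => ?.
apply: (@kernel_comm_sum _ (fun kl : I * I => #|{perm 'I_m}|%:R^-1 * M kl.1 kl.2)
  (fun kl => S kl.1 kl.2)) => kl.
exact: SC.
Qed.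

(** Kernels commuting with the symmetric group commute with t, so the double
    commutant theorem applies to the permutation operators. *)
Theorem first_fundamental_theorem t :
  (forall A, A \in unitmx -> kernel_comm (tensor_power A) t) ->
  exists c : {perm 'I_m} -> F,
    forall K L, t K L = \sum_s c s * (K == permute L s)%:R.
Proof.
move=> /tensor_power_comm tC.
pose mx (u : I -> I -> F) : 'M[F]_#|{: I}| := \matrix_(i, j) u (enum_val i) (enum_val j).
have mxM u v K L : (mx u *m mx v) (enum_rank K) (enum_rank L) = \sum_P u K P * v P L.
  rewrite mxE (reindex enum_rank)/=; last first.
    by exists enum_val => x _; [exact: enum_rankK|exact: enum_valK].
  by apply: eq_bigr => P _; rewrite !mxE !enum_rankK.
have mxC u v : mx u *m mx v = mx v *m mx u <-> kernel_comm u v.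
  split=> [E K L|C]; first by rewrite -!mxM E.
  by apply/matrixP => i j; rewrite -[i]enum_valK -[j]enum_valK !mxM.
pose rho (s : {perm 'I_m}) := mx (fun K L => (K == permute L s)%:R).
have [|s s'|M MC|c tE] := @double_centralizer F _ _ rho (mx t).
- apply/matrixP => i j; rewrite !mxE permute1 (inj_eq enum_val_inj).
  by [].
- apply/matrixP => i j; rewrite -[i]enum_valK -[j]enum_valK mxM !mxE !enum_rankK.
  rewrite (eq_bigr (fun P => (enum_val i == permute P s)%:R *
     (P == permute (enum_val j) s')%:R)) ?sum_pred1r ?permuteM//.
- pose M' K L := M (enum_rank K) (enum_rank L).
  have ME : M = mx M' by apply/matrixP => i j; rewrite mxE /M' !enum_valK.
  rewrite ME; apply/esym/mxC/symmetric_kernel_comm => // s K L.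
  have := MC s; rewrite ME => /mxC/(_ (permute K s) L).
  rewrite sum_pred1r => <-; rewrite (eq_bigr (fun P => (K == P)%:R * M' P L)).
    by rewrite sum_pred1l.
  by move=> P _; rewrite (inj_eq (@permute_inj s)).
exists c => K L; have := congr1 (fun X : 'M[F]_#|{: I}| => X (enum_rank K) (enum_rank L)) tE.
rewrite mxE !enum_rankK => ->; rewrite summxE; apply: eq_bigr => s _.
by rewrite !mxE !enum_rankK.
Qed.

End TensorInvariants.

(** * Symmetry of second derivatives *)

Section Calculus.
Context {R : realType}.

(** The order of a and b is left free, as increments of either sign occur. *)
Lemma MVT_dist (f df : R -> R) (a b : R) :
  (forall t : R, is_derive t 1 f (df t)) ->
  exists2 c, `|c - a| <= `|b - a| & f b - f a = df c * (b - a).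
Proof.
move=> fd.
have fc A : {within A, continuous f}.
  apply: continuous_subspaceT => t; apply: differentiable_continuous.
  exact/derivable1_diffP/(@ex_derive _ _ _ _ _ _ _ (fd t)).
have [ab|/ltW ba] := leP a b.
  have [c] := MVT_segment ab (fun x _ => fd x) (fc _).
  rewrite in_itv/= => /andP[ac cb] E; exists c => //.
  by rewrite !ger0_norm ?subr_ge0// lerD2r.
have [c] := MVT_segment ba (fun x _ => fd x) (fc _).
rewrite in_itv/= => /andP[bc ca] E; exists c.
  by rewrite !ler0_norm ?subr_le0// !opprB lerD2l lerN2.
by rewrite -opprB E -mulrN opprB.
Qed.

Context {d : nat}.

Lemma is_derive_line (W : normedModType R) (g : 'cV[R]_d -> W) x v (t : R) :
  smooth g -> is_derive t 1 (fun t => g (x + t *: v)) ('D_v g (x + t *: v)).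
Proof.
move=> sg.
have gd : derivable g (x + t *: v) v by apply/diff_derivable/smooth_differentiable.
have E : (fun h => h^-1 *: (((fun t => g (x + t *: v)) \o shift t) (h *: 1) - g (x + t *: v)))
    = (fun h => h^-1 *: ((g \o shift (x + t *: v)) (h *: v) - g (x + t *: v))).
  by apply/funext => h /=; rewrite [h *: 1]mulr1 scalerDl addrCA.
by apply: DeriveDef; rewrite /derivable/derive E.
Qed.

Lemma smooth_continuous (W : normedModType R) (g : 'cV[R]_d -> W) :
  smooth g -> continuous g.
Proof. by move=> sg x; apply/differentiable_continuous/smooth_differentiable. Qed.

(** The left-hand side is symmetric in u and v, while the mean value theorem,
    applied along u then along v, evaluates it as a second derivative. *)
Lemma second_difference (g : 'cV[R]_d -> R) x u v (h : R) : smooth g -> 0 < h ->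
  exists a b, [/\ `|a| <= h, `|b| <= h &
    g (x + h *: u + h *: v) - g (x + h *: u) - (g (x + h *: v) - g x) =
      'D_v ('D_u g) (x + a *: u + b *: v) * h * h].
Proof.
move=> sg h0.
have [|a ah Ea] := @MVT_dist (fun s => g (x + h *: v + s *: u) - g (x + s *: u))
   (fun s => 'D_u g (x + h *: v + s *: u) - 'D_u g (x + s *: u)) 0 h.
  by move=> t; apply: is_deriveB; exact: is_derive_line.
have [|b bh Eb] := @MVT_dist (fun s => 'D_u g (x + a *: u + s *: v))
   (fun s => 'D_v ('D_u g) (x + a *: u + s *: v)) 0 h.
  by move=> t; apply: is_derive_line; exact: smooth_derive.
move: ah bh Ea Eb; rewrite !subr0 (gtr0_norm h0) => ah bh Ea Eb.
exists a, b; split => //; rewrite -Eb scale0r addr0.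
rewrite [x + a *: u + _]addrAC -Ea !scale0r !addr0.
by rewrite [x + h *: v + _]addrAC.
Qed.

(** Both iterated derivatives equal the same second difference at points within
    any given distance of x; continuity concludes. *)
Lemma derive_comm_real (g : 'cV[R]_d -> R) u v : smooth g ->
  'D_u ('D_v g) = 'D_v ('D_u g).
Proof.
move=> sg; apply/funext => x; apply/eqP; rewrite -subr_eq0 -normr_le0.
apply/ler_addgt0Pr => e e0; rewrite add0r.
have close (A B M : R) : `|M - A| < e / 2 -> `|M - B| < e / 2 -> `|A - B| <= e.
  rewrite !ltr_norml !ler_norml => /andP[? ?] /andP[? ?];
    apply/andP; split; lra.
have near0 (G : 'cV[R]_d -> R) (w z : 'cV[R]_d) : continuous G -> 
    \forall h \near 0^'+, forall a b : R, `|a| <= h -> `|b| <= h -> `|G (x + a *: w + b *: z) - G x| < e / 2.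
  move=> cG.
  have cP : {for (0, 0), continuous (fun p : R * R => G (x + p.1 *: w + p.2 *: z))}.
    apply: (@continuous_comp _ _ _ (fun p : R * R => x + p.1 *: w + p.2 *: z)); last exact: cG.
    apply: continuousD; last by apply: continuousZr_tmp; exact: cvg_snd.
    by apply: continuousD; [exact: cvg_cst|apply: continuousZr_tmp; exact: cvg_fst].
  have /cvgr_dist_lt/(_ (e / 2)) : G (x + p.1 *: w + p.2 *: z) @[p --> ((0 : R), (0 : R))] --> G x.
    have := cP; rewrite /prop_for/continuous_at/= !scale0r !addr0; exact.
  rewrite divr_gt0// => /(_ isT) [[A B] /= [/nbhs_ballP[r1 /= r10 A1] /nbhs_ballP[r2 /= r20 B2]] AB].
  near=> h; move=> a b ah bh; rewrite distrC; apply: (AB (a, b)); split => /=.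
    apply: A1; rewrite /ball/= sub0r normrN; apply: (le_lt_trans ah).
    by near: h; apply: nbhs_right_lt.
  apply: B2; rewrite /ball/= sub0r normrN; apply: (le_lt_trans bh).
  by near: h; apply: nbhs_right_lt.
have c1 : continuous ('D_u ('D_v g)) by apply: smooth_continuous; do 2 apply: smooth_derive.
have c2 : continuous ('D_v ('D_u g)) by apply: smooth_continuous; do 2 apply: smooth_derive.
have N1 := near0 _ v u c1; have N2 := near0 _ u v c2.
have [h [h0 [P1 P2]]] := filter_ex (filterI (nbhs_right_gt (0 : R)) (filterI N1 N2)).
have [a [b [ah bh Eab]]] := @second_difference g x u v h sg h0.
have [a' [b' [ah' bh' Eab']]] := @second_difference g x v u h sg h0.
have swap (A B C D : R) : A - B - (C - D) = A - C - (B - D) by ring.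
rewrite [x + h *: v + h *: u]addrAC swap in Eab'.
have E := mulIf (lt0r_neq0 h0) (mulIf (lt0r_neq0 h0) (etrans (esym Eab) Eab')).
have Q2 := P2 _ _ ah bh; rewrite E in Q2.
exact: close (P1 _ _ ah' bh') Q2.
Unshelve. all: by end_near.
Qed.

End Calculus.

(** * Operators on vector fields *)

Section VectorFields.
Context {R : realType} {d : nat}.
Notation X := (vfield R d).
Implicit Types (f g h : X) (x : 'cV[R]_d) (xi : 'rV[R]_d) (mu : R).

Lemma vfieldD f g x : (f + g) x = f x + g x. Proof. by []. Qed.
Lemma vfieldZ a f x : (a *: f) x = a *: f x. Proof. by []. Qed.
Lemma vfieldB f g x : (f - g) x = f x - g x. Proof. by []. Qed.
Lemma vfield0 x : (0 : X) x = 0. Proof. by []. Qed.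

Lemma vfield_sum (I : Type) (r : seq I) (P : pred I) (F : I -> X) x :
  (\sum_(i <- r | P i) F i) x = \sum_(i <- r | P i) F i x.
Proof. exact: (big_morph (fun f : X => f x) (fun f g => vfieldD f g x) (vfield0 x)). Qed.

Lemma vfield_ext f g : (forall x, f x = g x) -> f = g.
Proof. by move=> fg; apply/val_inj/funext. Qed.

Lemma derive_coord (n : nat) (f : 'cV[R]_d -> 'cV[R]_n) (j : 'I_n) v x : smooth f ->
  'D_v f x j ord0 = 'D_v (fun y => f y j ord0) x.
Proof. move=> sf; rewrite (@derive_mx R 'cV[R]_d n 1 f x v) ?mxE//.
exact/diff_derivable/smooth_differentiable. Qed.

(** Partial derivatives as endomorphisms of the space of vector fields, so that
    the topology can be expressed inside that space. *)
Definition partial (i : 'I_d) f : X := VField (smooth_partial i (vfieldP f)).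
Definition partials (s : seq 'I_d) f : X := foldl (fun g i => partial i g) f s.

Lemma partialsE s f : partials s f = pderive s f :> ('cV[R]_d -> 'cV[R]_d).
Proof. by rewrite /partials; elim: s f => //= i s IHs f; rewrite IHs. Qed.

Lemma partial_comm i j f : partial i (partial j f) = partial j (partial i f).
Proof.
apply: vfield_ext => x; apply/matrixP => k l; rewrite (ord1 l).
pose fk y := f y k ord0.
have E i' j' : partial i' (partial j' f) x k ord0 =
    'D_(delta_mx i' ord0) ('D_(delta_mx j' ord0) fk) x.
  rewrite [LHS](derive_coord k (delta_mx i' ord0) x (smooth_partial j' (vfieldP f))).
  apply: (congr1 (fun G => 'D_(delta_mx i' ord0) G x)); apply/funext => y.
  exact: (derive_coord k (delta_mx j' ord0) y (vfieldP f)).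
have sfk : smooth fk by apply: smooth_coord; exact: vfieldP.
exact: etrans (E i j) (etrans (congr1 (fun G => G x) (derive_comm_real _ _ sfk)) (esym (E j i))).
Qed.

Lemma partial_lin i a f g : partial i (a *: f + g) = a *: partial i f + partial i g.
Proof.
apply: vfield_ext => x; rewrite vfieldD vfieldZ /=.
have df k : derivable (vfield_fun k) x (delta_mx i ord0).
  by apply/diff_derivable/smooth_differentiable/vfieldP.
by rewrite [LHS]deriveD ?deriveZ//; exact: derivableZ.
Qed.

Lemma partials_lin s a f g : partials s (a *: f + g) = a *: partials s f + partials s g.
Proof. by rewrite /partials; elim: s f g => //= i s IHs f g; rewrite partial_lin IHs. Qed.

Lemma partials0 s : partials s 0 = 0.
Proof. by have := partials_lin s (-1) 0 0; rewrite !scaleN1r !addNr. Qed.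

Lemma partialsD s f g : partials s (f + g) = partials s f + partials s g.
Proof. by rewrite -[f]scale1r partials_lin !scale1r. Qed.

Lemma partialsZ s a f : partials s (a *: f) = a *: partials s f.
Proof. by rewrite -[a *: f]addr0 partials_lin partials0 addr0. Qed.

Lemma partialsB s f g : partials s (f - g) = partials s f - partials s g.
Proof. by rewrite addrC -scaleN1r partials_lin scaleN1r addrC. Qed.

Lemma partials_sum s (I : Type) (r : seq I) (P : pred I) (F : I -> X) :
  partials s (\sum_(i <- r | P i) F i) = \sum_(i <- r | P i) partials s (F i).
Proof. exact: (big_morph (partials s) (partialsD s) (partials0 s)). Qed.

Fact dilate_smooth mu f : smooth (fun x => f (mu *: x)).
Proof.
rewrite (_ : (fun x => _) = fun x => 1%:M *m f (mu%:M *m (x - 0))).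
  by apply: smooth_affine; exact: vfieldP.
by apply/funext => x; rewrite mul1mx subr0 mul_scalar_mx.
Qed.
Definition dilate mu f : X := VField (dilate_smooth mu f).

Lemma partial_dilate i mu f : partial i (dilate mu f) = mu *: dilate mu (partial i f).
Proof.
apply: vfield_ext => x; rewrite vfieldZ /=.
have sf := vfieldP f.
have -> : mu *: 'D_(delta_mx i ord0) f (mu *: x) = 'D_(mu *: delta_mx i ord0) f (mu *: x).
  have df := smooth_differentiable (mu *: x) sf.
  by rewrite (deriveE (mu *: delta_mx i ord0) df) (deriveE (delta_mx i ord0) df) linearZ.
apply: (congr1 (fun u : R -> 'cV[R]_d => lim (u h @[h --> 0^']))); apply/funext => h /=.
by rewrite [mu *: (_ + _)]scalerDr [mu *: (h *: _)]scalerA [h *: (mu *: _)]scalerA [mu * h]mulrC.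
Qed.

Fact smooth_id : smooth (id : 'cV[R]_d -> 'cV[R]_d).
Proof.
pose P (h : 'cV[R]_d -> 'cV[R]_d) := h = id \/ exists c, h = cst c.
have PS (h : 'cV[R]_d -> 'cV[R]_d) : P h -> (forall x, differentiable h x) /\ forall i, P ('D_(delta_mx i ord0) h).
  move=> [->|[c ->]]; split=> [x|i].
  - exact: ex_diff.
  - by right; exists (delta_mx i ord0); apply/funext => x; rewrite derive_id.
  - exact: differentiable_cst.
  - by right; exists 0; apply/funext => x; rewrite derive_cst.
exact: (smooth_coind PS (or_introl erefl)).
Qed.

Fact form_smooth xi : smooth (fun x => (xi *m x) ord0 ord0).
Proof.
rewrite (_ : (fun x => _) = \sum_l (xi ord0 l *: (fun x => x l ord0))).
  apply: smooth_sum => l; apply: smoothZ.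
  exact: (@smooth_coord R d d id l smooth_id).
by apply/funext => x; rewrite mxE fct_sumE.
Qed.

Fact form_mul_smooth xi f : smooth (fun x => (xi *m x) ord0 ord0 *: f x).
Proof.
rewrite (_ : (fun x => _) = fun x => \col_j ((fun x => (xi *m x) ord0 ord0) * (fun x => f x j ord0)) x).
  by apply: smooth_col => j; apply: smoothM; [exact: form_smooth|apply: smooth_coord; exact: vfieldP].
by apply/funext => x; apply/matrixP => j k; rewrite (ord1 k) [LHS]mxE [RHS]mxE.
Qed.
Definition form_mul xi f : X := VField (form_mul_smooth xi f).

Lemma form_mulE xi f x : form_mul xi f x = (xi *m x) ord0 ord0 *: f x.
Proof. by []. Qed.

Lemma form_mul_linr xi a f g :
  form_mul xi (a *: f + g) = a *: form_mul xi f + form_mul xi g.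
Proof.
by apply: vfield_ext => x; rewrite vfieldD vfieldZ !form_mulE vfieldD vfieldZ scalerDr !scalerA mulrC.
Qed.

Lemma form_mul_linl xi zeta a f :
  form_mul (a *: xi + zeta) f = a *: form_mul xi f + form_mul zeta f.
Proof.
by apply: vfield_ext => x; rewrite vfieldD vfieldZ !form_mulE mulmxDl -scalemxAl !mxE scalerDl scalerA.
Qed.

Lemma partial_form_mul i xi f :
  partial i (form_mul xi f) = xi ord0 i *: f + form_mul xi (partial i f).
Proof.
apply: vfield_ext => x; rewrite vfieldD vfieldZ form_mulE /=.
apply: cvg_lim => //.
set v := delta_mx i ord0 : 'cV[R]_d.
have xiv : (xi *m v) ord0 ord0 = xi ord0 i by rewrite -colE mxE.
have E (h : R) : h != 0 -> xi ord0 i *: f (h *: v + x) + (xi *m x) ord0 ord0 *: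
    (h^-1 *: ((f \o shift x) (h *: v) - f x)) =
    h^-1 *: (((fun x0 => (xi *m x0) ord0 ord0 *: f x0) \o shift x) (h *: v) - (xi *m x) ord0 ord0 *: f x).
  move=> h0 /=.
  have -> : (xi *m (h *: v + x)) ord0 ord0 = h * xi ord0 i + (xi *m x) ord0 ord0.
    by rewrite mulmxDr -scalemxAr mxE [X in X + _]mxE xiv.
  move: (f (h *: v + x)) (f x) ((xi *m x) ord0 ord0) (xi ord0 i) => A B a c.
  rewrite [in RHS]scalerDl -addrA -scalerBr [in RHS]scalerDr ![in RHS]scalerA mulrA mulVf// mul1r.
  by rewrite scalerA [a * _]mulrC.
apply: (@cvg_trans _ ((fun h : R => xi ord0 i *: f (h *: v + x) + (xi *m x) ord0 ord0 *:
    (h^-1 *: ((f \o shift x) (h *: v) - f x))) @ 0^')).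
  apply: near_eq_cvg; near=> h; apply: E; near: h; exact: nbhs_dnbhs_neq.
apply: cvgD; apply: cvgZl_tmp; last exact/diff_derivable/smooth_differentiable/vfieldP.
apply: (@continuous_cvg _ _ _ _ _ (fun h : R => h *: v + x) f).
  exact/smooth_continuous/vfieldP.
have : (h *: v + x) @[h --> (0 : R)^'] --> 0 *: v + x.
  by apply: cvgD; [apply: cvgZr_tmp; exact: nbhs_dnbhs|exact: cvg_cst].
by rewrite scale0r add0r.
Unshelve. all: by end_near.
Qed.

Fact cst_smooth (w : 'cV[R]_d) : smooth (fun _ : 'cV[R]_d => w).
Proof. exact: smooth_cst. Qed.
Definition cst_field w : X := VField (cst_smooth w).

End VectorFields.

(** * The topology of vector fields *)

Section InitialConvergence.

Lemma cvg_initialP (S : choiceType) (T : topologicalType) (f : S -> T)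
    (F : set_system S) (s : S) : Filter F ->
  F --> (s : initial_topology f) <-> f @ F --> f s.
Proof.
move=> FF; split=> [Fs|Ffs].
  by apply: (cvg_comp _ f Fs); exact: (@initial_continuous S T f).
move=> A /= [_ [[B Bop <-] Bfs sBfA]].
rewrite nbhs_filterE; apply: (filterS sBfA); apply: Ffs.
by rewrite nbhsE; exists B.
Qed.

Lemma cvg_ptwsP (U : Type) (V : topologicalType) (F : set_system (U -> V)) (f : U -> V) :
  Filter F -> {ptws, F --> f} <-> forall t, (fun g => g t) @ F --> f t.
Proof.
move=> FF; split=> [/cvg_sup Ff t|Ff].
  exact/cvg_initialP/Ff.
by apply/cvg_sup => t; apply/cvg_initialP/Ff.
Qed.

End InitialConvergence.

Section VectorFieldTopology.
Context {R : realType} {d : nat}.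
Notation X := (vfield R d).

Lemma cvg_vfieldP (T : Type) (F : set_system T) (g : T -> X) (l : X) : Filter F ->
  g t @[t --> F] --> l <->
  forall s K, compact K -> forall e, 0 < e ->
    \forall t \near F, forall x, K x -> `|partials s (g t) x - partials s l x| < e.
Proof.
move=> FF.
have -> : (g t @[t --> F] --> l) = ((g @ F : set_system X) --> (l : initial_topology (@jet R d))) by [].
rewrite cvg_initialP cvg_ptwsP; split=> [gl s K cK e e0|gl s].
  have /fam_cvgP/(_ K cK) Fl := gl s.
  have Q : nbhs (jet l s : {uniform` K -> 'cV[R]_d})
      [set h | forall x, K x -> `|h x - partials s l x| < e].
    apply/uniform_nbhs; exists [set p | ball p.1 e p.2]; split.
      by rewrite -entourage_ballE; exists e.
    by move=> h Kh x Kx; have := Kh x Kx; rewrite -ball_normE /ball_/= distrC partialsE.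
  apply: (@filterS _ F FF _ _ _ (Fl _ Q)) => t /= Ht x Kx.
  by have := Ht x Kx; rewrite /jet !partialsE.
apply/fam_cvgP => K cK P /uniform_nbhs[E [entE EP]].
move: entE; rewrite -entourage_ballE => -[e /= e0 eE].
have := gl s K cK e e0; apply: filterS => t Ht; apply: EP => x Kx.
apply: eE => /=; rewrite -ball_normE /ball_/= distrC.
by have := Ht x Kx; rewrite !partialsE.
Qed.

End VectorFieldTopology.

(** * Dilation curves are differentiable *)

Section Dilation.
Context {R : realType} {d : nat}.
Notation X := (vfield R d).
Implicit Types (f g h : X) (x : 'cV[R]_d) (mu : R).

Lemma col_norm_lt (v : 'cV[R]_d) (e : R) : 0 < e ->
  `|v| < e <-> forall j, `|v j ord0| < e.
Proof.
move=> e0; split=> [ve j|ve].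
  apply: le_lt_trans ve; rewrite [leRHS]/Num.norm/= mx_normrE.
  by apply/bigmax_geP; right => /=; exists (j, ord0).
rewrite /Num.norm/= mx_normrE; apply/bigmax_ltP; split=> // -[i j] _ /=.
by rewrite (ord1 j).
Qed.

(** Tube lemma: joint continuity gives uniformity on compact sets. *)
Lemma near_compact_uniform (T : topologicalType) (G : T * 'cV[R]_d -> 'cV[R]_d)
    (t0 : T) (K : set 'cV[R]_d) (e : R) :
  continuous G -> compact K -> 0 < e ->
  \forall t \near t0, forall x, K x -> `|G (t, x) - G (t0, x)| < e.
Proof.
move=> cG /compact_near_coveringP cK e0.
apply: (cK T (nbhs t0) (fun t x => `|G (t, x) - G (t0, x)| < e)) => x Kx.
have e20 : 0 < e / 2 by rewrite divr_gt0.
have /cvgr_dist_lt/(_ _ e20) [[A B] /= [At Bx] AB] : G p @[p --> (t0, x)] --> G (t0, x).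
  exact: cG.
exists (B, A) => //= -[y t] /= [By At'].
have P1 := AB (t, y) (conj At' By); have P2 := AB (t0, y) (conj (nbhs_singleton At) By).
rewrite -(subrKA (G (t0, x))) (splitr e) (le_lt_trans (ler_normD _ _))// ltrD//.
by rewrite distrC.
Qed.

(** The mu-derivative of f (mu x): the Euler-type field of components
    sum_l x_l (d_l f) (mu x). *)
Definition euler_dilate mu h : X :=
  \sum_l form_mul (delta_mx ord0 l) (dilate mu (partial l h)).

(** The two terms are those of the mu-derivative of mu (d_i h) (mu x), which is
    d_i of the dilated field; this uses that d_i and d_l commute. *)
Lemma partial_euler_dilate i mu h :
  partial i (euler_dilate mu h) =
  dilate mu (partial i h) + mu *: euler_dilate mu (partial i h).
Proof.
rewrite /euler_dilate.
have -> : partial i (\sum_l form_mul (delta_mx ord0 l) (dilate mu (partial l h))) =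
   \sum_l partial i (form_mul (delta_mx ord0 l) (dilate mu (partial l h))).
  exact: (partials_sum [:: i]).
have fmZ xi a f : form_mul xi (a *: f) = a *: form_mul xi f.
  by apply: vfield_ext => x; rewrite vfieldZ !form_mulE vfieldZ !scalerA mulrC.
under eq_bigr => l _ do rewrite partial_form_mul partial_dilate partial_comm fmZ mxE eqxx/=.
rewrite big_split/= -scaler_sumr; congr (_ + _).
rewrite (bigD1 i)//= eqxx scale1r big1 ?addr0// => l li.
by rewrite eq_sym (negPf li) scale0r.
Qed.

Lemma euler_dilateE mu h x :
  euler_dilate mu h x = \sum_l x l ord0 *: partial l h (mu *: x).
Proof.
rewrite vfield_sum; apply: eq_bigr => l _; rewrite form_mulE.
by congr (_ *: _); rewrite -rowE mxE.
Qed.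

Lemma partials_dilate s mu h :
  partials s (dilate mu h) = mu ^+ size s *: dilate mu (partials s h).
Proof.
elim: s h => [|i s IHs] h /=; first by rewrite expr0 scale1r.
by rewrite partial_dilate partialsZ IHs scalerA exprS.
Qed.

(** Pointwise, differentiation in mu commutes with all partial derivatives in
    x. *)
Lemma is_derive_dilate s h x j mu :
  is_derive mu 1 (fun mu => partials s (dilate mu h) x j ord0)
    (partials s (euler_dilate mu h) x j ord0).
Proof.
elim: s h mu => [|i s IHs] h mu /=.
  pose g y := h y j ord0.
  have sg : smooth g by apply: smooth_coord; exact: vfieldP.
  rewrite (_ : (fun mu => _) = (fun t => g (0 + t *: x))); last first.
    by apply/funext => t; rewrite add0r.
  apply: is_derive_eq; first exact: is_derive_line.
  rewrite add0r; apply: (etrans (congr1 (fun G => G (mu *: x)) (derive_pderive x sg))).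
  rewrite fct_sumE euler_dilateE summxE.
  apply: eq_bigr => l _; rewrite [RHS]mxE; congr (_ * _).
  exact: (esym (derive_coord j (delta_mx l ord0) (mu *: x) (vfieldP h))).
have -> : (fun mu => partials s (partial i (dilate mu h)) x j ord0) =
          (id : R -> R) * (fun mu => partials s (dilate mu (partial i h)) x j ord0).
  by apply/funext => nu; rewrite partial_dilate partialsZ vfieldZ mxE.
apply: is_derive_eq.
rewrite partial_euler_dilate partialsD partialsZ vfieldD vfieldZ [RHS]mxE [X in _ = _ + X]mxE.
by rewrite addrC; congr (_ + _); exact: mulr1.
Qed.

Lemma dilate_continuous s h :
  continuous (fun p : R * 'cV[R]_d => partials s (dilate p.1 h) p.2).
Proof.
rewrite (_ : (fun p => _) = fun p : R * 'cV[R]_d =>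
    p.1 ^+ size s *: partials s h (p.1 *: p.2)); last first.
  by apply/funext => p; rewrite partials_dilate vfieldZ.
move=> p; apply: cvgZ.
  apply: (@continuous_cvg _ _ _ _ _ fst (fun t : R => t ^+ size s)).
    exact: exprn_continuous.
  exact: cvg_fst.
apply: (@continuous_comp _ _ _ (fun p : R * 'cV[R]_d => p.1 *: p.2)).
  by apply: cvgZ; [exact: cvg_fst|exact: cvg_snd].
exact/smooth_continuous/vfieldP.
Qed.

Lemma euler_dilate_continuous s h :
  continuous (fun p : R * 'cV[R]_d => partials s (euler_dilate p.1 h) p.2).
Proof.
elim: s h => [|i s IHs] h /=.
  rewrite (_ : (fun p => _) = \sum_l (fun p : R * 'cV[R]_d =>
      p.2 l ord0 *: partial l h (p.1 *: p.2))); last first.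
    by apply/funext => p; rewrite euler_dilateE fct_sumE.
  apply: (big_ind (fun f : R * 'cV[R]_d -> 'cV[R]_d => continuous f)).
  - by move=> p; exact: cvg_cst.
  - by move=> f g cf cg p; apply: cvgD; [exact: cf|exact: cg].
  - move=> l _ p; apply: cvgZ.
      apply: (@continuous_comp _ _ _ snd (fun v : 'cV[R]_d => v l ord0)).
        exact: cvg_snd.
      exact: coord_continuous.
    exact: (@dilate_continuous [::] (partial l h) p).
rewrite (_ : (fun p => _) = fun p : R * 'cV[R]_d =>
    partials s (dilate p.1 (partial i h)) p.2 +
    p.1 *: partials s (euler_dilate p.1 (partial i h)) p.2); last first.
  by apply/funext => p; rewrite partial_euler_dilate partialsD partialsZ.
move=> p; apply: cvgD; first exact: dilate_continuous.
by apply: cvgZ; [exact: cvg_fst|exact: IHs].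
Qed.

(** The mean value theorem writes the difference quotient at x as the derivative
    at a nearby parameter; joint continuity makes this uniform on compacts. *)
Lemma dilate_cvg mu h :
  r^-1 *: (dilate (mu + r) h - dilate mu h) @[r --> (0 : R)^'] --> euler_dilate mu h.
Proof.
apply/cvg_vfieldP => s K cK e e0.
have [delta /= delta0 near_mu] := near_compact_uniform mu
  (@euler_dilate_continuous s h) cK e0.
near=> r; move=> x Kx; apply/col_norm_lt => // j.
have rN0 : r != 0 by near: r; exact: nbhs_dnbhs_neq.
have rdelta : `|r| < delta.
  near: r; apply: dnbhs0_lt => //.
have [c cr E] := MVT_dist mu (mu + r) (is_derive_dilate s h x j).
rewrite addrAC subrr add0r in cr E.
have -> : (partials s (r^-1 *: (dilate (mu + r) h - dilate mu h)) x -
    partials s (euler_dilate mu h) x) j ord0 =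
    (partials s (euler_dilate c h) x - partials s (euler_dilate mu h) x) j ord0.
  rewrite partialsZ vfieldZ partialsB vfieldB [LHS]mxE [RHS]mxE; congr (_ + _).
  by rewrite [LHS]mxE [X in _ * X]mxE [X in _ * (_ + X)]mxE E mulrC mulfK.
apply: (col_norm_lt _ e0).1; apply: near_mu => //=.
by rewrite distrC (le_lt_trans cr).
Unshelve. all: by end_near.
Qed.

End Dilation.

(** * Continuity of the vector field operations *)

Section Convergence.
Context {R : realType} {d : nat}.
Notation X := (vfield R d).
Context {T : Type} (F : set_system T) {FF : Filter F}.
Implicit Types (g : T -> X) (l : X) (a : T -> R).

Lemma compact_bound (W : normedModType R) (h : 'cV[R]_d -> W) K :
  continuous h -> compact K -> exists2 M, 0 < M & forall x, K x -> `|h x| <= M.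
Proof.
move=> ch cK.
have /pinfty_ex_gt0[M M0 hM] :=
  compact_bounded (continuous_compact (continuous_subspaceT ch) cK).
by exists M => // x Kx; apply: hM; exists x.
Qed.

Lemma vfield_cvg_eval g l x j : g t @[t --> F] --> l ->
  g t x j ord0 @[t --> F] --> l x j ord0.
Proof.
move=> /cvg_vfieldP gl; apply/cvgrPdist_lt => e e0.
have := gl [::] [set x] (@compact_set1 _ x) e e0; apply: filterS => t /(_ x erefl).
by move=> /(col_norm_lt _ e0)/(_ j); rewrite /= distrC !mxE.
Qed.

Lemma vfield_cvg_partial i g l : g t @[t --> F] --> l ->
  partial i (g t) @[t --> F] --> partial i l.
Proof.
by move=> /cvg_vfieldP gl; apply/cvg_vfieldP => s; exact: (gl (i :: s)).
Qed.

Lemma vfield_cvgD g1 g2 l1 l2 :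
  g1 t @[t --> F] --> l1 -> g2 t @[t --> F] --> l2 -> g1 t + g2 t @[t --> F] --> l1 + l2.
Proof.
move=> /cvg_vfieldP gl1 /cvg_vfieldP gl2; apply/cvg_vfieldP => s K cK e e0.
have e20 : 0 < e / 2 by rewrite divr_gt0.
have := gl1 s K cK _ e20; have := gl2 s K cK _ e20; apply: filterS2 => t H2 H1 x Kx.
rewrite !partialsD !vfieldD opprD addrACA (splitr e).
by apply: le_lt_trans (ler_normD _ _) _; apply: ltrD; [exact: H1|exact: H2].
Qed.

Lemma vfield_cvgZ a (b : R) g l :
  a t @[t --> F] --> b -> g t @[t --> F] --> l -> a t *: g t @[t --> F] --> b *: l.
Proof.
move=> ab /cvg_vfieldP gl; apply/cvg_vfieldP => s K cK e e0.
have [M M0 lM] := compact_bound (smooth_continuous (vfieldP (partials s l))) cK.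
have b0 : 0 < `|b| + 1 by rewrite ltr_wpDl.
have e1 : 0 < e / 2 / (`|b| + 1) by rewrite !divr_gt0.
have e2 : 0 < e / 2 / M by rewrite !divr_gt0.
have H1 := gl s K cK _ e1.
have /cvgrPdist_lt/(_ _ e2) H2 := ab.
have /cvgrPdist_lt/(_ _ ltr01) H3 := ab.
near=> t; move=> x Kx.
rewrite !partialsZ !vfieldZ.
have -> : a t *: partials s (g t) x - b *: partials s l x =
    a t *: (partials s (g t) x - partials s l x) + (a t - b) *: partials s l x.
  by rewrite scalerBr scalerBl addrA subrK.
apply: le_lt_trans (ler_normD _ _) _; rewrite !normrZ (splitr e).
have tb : `|a t| < `|b| + 1.
  have : `|b - a t| < 1 by near: t.
  rewrite distrC => /(le_lt_trans _) tb; rewrite -(subrK b (a t)) addrC.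
  by apply: le_lt_trans (ler_normD _ _) _; rewrite ltrD2l; exact: tb.
have gt1 : `|partials s (g t) x - partials s l x| < e / 2 / (`|b| + 1).
  have K' : forall x, K x -> `|partials s (g t) x - partials s l x| < e / 2 / (`|b| + 1) by near: t.
  exact: K'.
have at2 : `|a t - b| < e / 2 / M by rewrite distrC; near: t.
apply: ltr_leD.
  rewrite -[ltRHS](@divfK _ (`|b| + 1)) ?gt_eqF// mulrC.
  by apply: ltr_pM.
rewrite -[leRHS](@divfK _ M) ?gt_eqF//.
by apply: ler_pM => //; [exact: ltW|exact: lM].
Unshelve. all: by end_near.
Qed.

Lemma vfield_cvg_form_mul xi g l : g t @[t --> F] --> l ->
  form_mul xi (g t) @[t --> F] --> form_mul xi l.
Proof.
move=> gl; apply/cvg_vfieldP => s; elim: s g l gl => [|i s IHs] g l gl K cK e e0.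
  have [M M0 lM] := compact_bound (smooth_continuous (form_smooth xi)) cK.
  move/cvg_vfieldP : gl => gl.
  have := gl [::] K cK _ (divr_gt0 e0 M0); apply: filterS => t Ht x Kx /=.
  rewrite -scalerBr normrZ -[ltRHS](@divfK _ M) ?gt_eqF// mulrC.
  apply: le_lt_trans (ler_wpM2l (normr_ge0 _) (lM x Kx)) _.
  by rewrite ltr_pM2r//; exact: Ht.
have e20 : 0 < e / 2 by rewrite divr_gt0.
have H1 := IHs _ _ (vfield_cvg_partial (i := i) gl) K cK _ e20.
have /cvg_vfieldP H2 : xi ord0 i *: g t @[t --> F] --> xi ord0 i *: l.
  by apply: vfield_cvgZ gl; exact: cvg_cst.
have := H2 s K cK _ e20; apply: filterS2 H1 => t H1 {}H2 x Kx.
rewrite /= !partial_form_mul !partialsD !vfieldD opprD addrACA (splitr e).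
by apply: le_lt_trans (ler_normD _ _) _; apply: ltrD; [exact: H2|exact: H1].
Qed.

End Convergence.

(** * Multilinearity of iterated Frechet derivatives *)

Definition update (I : eqType) (U : Type) (u : I -> U) (v : I) (h : U) : I -> U :=
  fun i => if i == v then h else u i.

Definition multilinear (R : pzRingType) (I : eqType) (U : lmodType R)
    (f : (I -> U) -> R) : Prop :=
  forall u v a h k,
    f (update u v (a *: h + k)) = a * f (update u v h) + f (update u v k).

Section FrechetDerivative.
Context {R : realType} {d : nat} (phi : vfield R d -> vfield R d).
Hypothesis phi_smooth : frechet_smooth phi.
Notation X := (vfield R d).
Context (x : 'cV[R]_d) (j : 'I_d).
Implicit Types (f h k : X) (hs : seq X).

(** Testing on the functionals of evaluation at x of one component reduces
    limits of vector fields to real limits, which are unique. *)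
Definition fderive_at hs f : R := fderive phi hs f x j ord0.

Lemma fderive_at_cvg hs f h :
  t^-1 * (fderive_at hs (f + t *: h) - fderive_at hs f) @[t --> (0 : R)^'] -->
  fderive_at (h :: hs) f.
Proof.
have H : diff_quot (fderive phi hs) f h t @[t --> (0 : R)^'] --> fderive phi (h :: hs) f.
  exact: (phi_smooth.1 hs f h).
have E : (fun t => diff_quot (fderive phi hs) f h t x j ord0) =
  (fun t => t^-1 * (fderive_at hs (f + t *: h) - fderive_at hs f)).
  apply/funext => t.
  by rewrite /diff_quot vfieldZ vfieldB [LHS]mxE [X in _ * X]mxE [X in _ * (_ + X)]mxE.
by rewrite -E; exact: vfield_cvg_eval.
Qed.

Lemma fderive_at_continuous (m : nat) (T : Type) (F : set_system T) (FF : Filter F)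
    (g : T -> X) (u : T -> 'I_m -> X) l v :
  g t @[t --> F] --> l -> (forall i, u t i @[t --> F] --> v i) ->
  fderive_at [seq u t i | i : 'I_m] (g t) @[t --> F] --> fderive_at [seq v i | i : 'I_m] l.
Proof.
move=> gl uv; apply: vfield_cvg_eval.
have uv' : u t @[t --> F] --> (v : {ptws 'I_m -> X}).
  exact: ((@cvg_ptwsP 'I_m X (u @ F) v _).2 uv).
have C := @phi_smooth.2 m (l, v).
have P : (g t, (u t : {ptws 'I_m -> X})) @[t --> F] --> (l, (v : {ptws 'I_m -> X})).
  move=> U [[A B] [/= Al Bv] AB]; 
  exact: (@filterS2 T F FF _ _ _ (fun t At Bt => AB (g t, u t) (conj At Bt)) (gl _ Al) (uv' _ Bv)).
exact: (cvg_comp _ _ P C).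
Qed.

Lemma fderive_at_continuous_base hs (T : Type) (F : set_system T) (FF : Filter F) (g : T -> X) l :
  g t @[t --> F] --> l -> fderive_at hs (g t) @[t --> F] --> fderive_at hs l.
Proof.
move=> gl; have := @fderive_at_continuous (size hs) T F FF g (fun _ => tnth (in_tuple hs)) l
  (tnth (in_tuple hs)) gl (fun i => cvg_cst _).
have -> : [seq tnth (in_tuple hs) i | i : 'I_(size hs)] = hs.
  exact: (map_tnth_enum (in_tuple hs)).
exact.
Qed.

Lemma is_derive_fderive_at hs f h (t : R) :
  is_derive t 1 (fun t : R => fderive_at hs (f + t *: h)) (fderive_at (h :: hs) (f + t *: h)).
Proof.
have H := @fderive_at_cvg hs (f + t *: h) h.
have E : (fun r => r^-1 *: (((fun t => fderive_at hs (f + t *: h)) \o shift t) (r *: 1)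
     - fderive_at hs (f + t *: h))) =
    (fun r => r^-1 * (fderive_at hs (f + t *: h + r *: h) - fderive_at hs (f + t *: h))).
  by apply/funext => r /=; rewrite [r *: 1]mulr1 scalerDl [r *: h + _]addrC addrA.
apply: DeriveDef; rewrite /derivable/derive E; first by apply: (cvgP _ H).
exact: cvg_lim H.
Qed.

(** Existence of directional derivatives that are jointly continuous forces
    linearity: go first along k, then along h, where the mean value theorem
    produces the derivative at a point f + t k + c h that tends to f. *)
Lemma fderive_at_lin_head hs a h k f :
  fderive_at ((a *: h + k) :: hs) f =
  a * fderive_at (h :: hs) f + fderive_at (k :: hs) f.
Proof.
have M t : {c | `|c| <= `|t * a| & fderive_at hs (f + t *: k + (t * a) *: h) -
    fderive_at hs (f + t *: k) = fderive_at (h :: hs) (f + t *: k + c *: h) * (t * a)}.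
  apply/cid2; have [c] := MVT_dist 0 (t * a) (is_derive_fderive_at hs (f + t *: k) h).
  by rewrite !subr0 scale0r addr0; exists c.
pose c t := s2val (M t).
have c0 : c t @[t --> (0 : R)^'] --> 0.
  apply/norm_cvg0P; apply: (@squeeze_cvgr _ _ _ _ (cst 0) (fun t => `|t * a|)).
  - by near=> t; rewrite normr_ge0 (s2valP (M t)).
  - exact: cvg_cst.
  - have ta : t * a @[t --> (0 : R)^'] --> 0 * a.
      by apply: cvgM; [exact: nbhs_dnbhs|exact: cvg_cst].
    have tn : `|t * a| @[t --> (0 : R)^'] --> `|0 * a| by exact: cvg_norm ta.
    rewrite mul0r normr0 in tn. exact: tn.
have base : (f + t *: k + c t *: h) @[t --> (0 : R)^'] --> f.
  have := vfield_cvgD (vfield_cvgD (cvg_cst f) (vfield_cvgZ (@nbhs_dnbhs _ (0 : R)) (cvg_cst k)))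
    (vfield_cvgZ c0 (cvg_cst h)).
  rewrite !scale0r !addr0; exact.
have L1 : fderive_at (h :: hs) (f + t *: k + c t *: h) * a @[t --> (0 : R)^'] -->
    fderive_at (h :: hs) f * a.
  by apply: cvgM; [exact: fderive_at_continuous_base base|exact: cvg_cst].
have L2 : t^-1 * (fderive_at hs (f + t *: (a *: h + k)) - fderive_at hs f)
    @[t --> (0 : R)^'] --> fderive_at (h :: hs) f * a + fderive_at (k :: hs) f.
  apply: cvg_trans (cvgD L1 (@fderive_at_cvg hs f k)).
  apply: near_eq_cvg; near=> t => /=.
  have t0 : t != 0 by near: t; exact: nbhs_dnbhs_neq.
  have -> : f + t *: (a *: h + k) = f + t *: k + (t * a) *: h.
    by rewrite scalerDr scalerA -addrA [t *: k + _]addrC.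
  rewrite -(subrK (fderive_at hs (f + t *: k)) (fderive_at hs (_ + (t * a) *: h))).
  rewrite (s2valP' (M t)) -/(c t) -addrA mulrDr; congr (_ + _).
  by rewrite mulrCA mulKf.
rewrite mulrC -(cvg_lim _ L2)//; apply/esym; exact: cvg_lim (@fderive_at_cvg hs f (a *: h + k)).
Unshelve. all: by end_near.
Qed.

(** A slot behind the head is linear because the head derivative is a limit of
    combinations of terms that are linear in that slot. *)
Lemma fderive_at_lin s1 s2 a h k f :
  fderive_at (s1 ++ (a *: h + k) :: s2) f =
  a * fderive_at (s1 ++ h :: s2) f + fderive_at (s1 ++ k :: s2) f.
Proof.
elim: s1 f => [|g s1 IHs] f /=; first exact: fderive_at_lin_head.
have alg (r A A0 B B0 : R) :
  r * (a * A + B - (a * A0 + B0)) = a * (r * (A - A0)) + r * (B - B0) by ring.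
have L := @fderive_at_cvg (s1 ++ (a *: h + k) :: s2) f g.
have L1 := @fderive_at_cvg (s1 ++ h :: s2) f g.
have L2 := @fderive_at_cvg (s1 ++ k :: s2) f g.
rewrite -(cvg_lim _ L)//; apply: cvg_lim => //.
apply: cvg_trans (cvgD (cvgM (cvg_cst a) L1) L2).
apply: near_eq_cvg; near=> t => /=; rewrite !IHs.
apply/esym; exact: alg.
Unshelve. all: by end_near.
Qed.

Lemma fderive_at_multilinear (m : nat) f :
  multilinear (fun u : 'I_m -> X => fderive_at [seq u i | i : 'I_m] f).
Proof.
move=> u v a h k.
have E w : [seq update u v w i | i : 'I_m] =
    [seq u i | i <- take v (enum 'I_m)] ++ w :: [seq u i | i <- drop v.+1 (enum 'I_m)].
  have vm : (v < size (enum 'I_m))%N by rewrite size_enum_ord.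
  have E : enum 'I_m = take v (enum 'I_m) ++ v :: drop v.+1 (enum 'I_m).
    rewrite -[LHS](cat_take_drop v) (drop_nth v vm); congr (_ ++ _ :: _).
    by apply: val_inj; rewrite /= nth_enum_ord.
  have : uniq (enum 'I_m) by exact: enum_uniq.
  rewrite {1}E cat_uniq /= => /and3P[_ /norP[vt _] /andP[vd _]].
  rewrite /image_mem [in LHS]E map_cat /= /update eqxx; congr (_ ++ _ :: _).
    by apply/eq_in_map => i it; case: eqP it vt => // -> ->.
  by apply/eq_in_map => i it; case: eqP it vd => // -> ->.
by rewrite !E fderive_at_lin.
Qed.

End FrechetDerivative.

(** * Multilinear expansions and the Leibniz rule *)

Section FunctionsOnOrdinals.
Context {A : finType} {n : nat}.

Definition fcons (a : A) (w : {ffun 'I_n -> A}) : {ffun 'I_n.+1 -> A} :=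
  [ffun i => if unlift ord0 i is Some j then w j else a].

Lemma fcons0 a w : fcons a w ord0 = a.
Proof. by rewrite ffunE unlift_none. Qed.

Lemma fconsS a w i : fcons a w (lift ord0 i) = w i.
Proof. by rewrite ffunE liftK. Qed.

Lemma fcons_eta (w : {ffun 'I_n.+1 -> A}) :
  fcons (w ord0) [ffun i => w (lift ord0 i)] = w.
Proof.
apply/ffunP => i; case: (unliftP ord0 i) => [j ->|->]; first by rewrite fconsS ffunE.
by rewrite fcons0.
Qed.

Lemma big_ffunS (V : nmodType) (F : {ffun 'I_n.+1 -> A} -> V) :
  \sum_w F w = \sum_a \sum_w F (fcons a w).
Proof.
rewrite pair_bigA/= (reindex (fun p => fcons p.1 p.2))//=.
exists (fun w => (w ord0, [ffun i => w (lift ord0 i)])) => [[a w] _|w _] /=.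
  by congr (_, _); [rewrite fcons0|apply/ffunP => i; rewrite ffunE fconsS].
exact: fcons_eta.
Qed.

End FunctionsOnOrdinals.

Lemma big_ffun0 (V : nmodType) (A : finType) (F : {ffun 'I_0 -> A} -> V) (w : {ffun 'I_0 -> A}) :
  \sum_v F v = F w.
Proof.
have vw v : v = w by apply/ffunP => -[].
by rewrite (bigD1 w)//= big1 ?addr0// => v /eqP; rewrite (vw v).
Qed.

Section Multilinear.
Context {R : numFieldType} {U : lmodType R}.

Lemma multilinearD (I : eqType) (f : (I -> U) -> R) u v h k : multilinear f ->
  f (update u v (h + k)) = f (update u v h) + f (update u v k).
Proof. by move=> fl; rewrite -[h]scale1r fl mul1r scale1r. Qed.

Lemma multilinear0 (I : eqType) (f : (I -> U) -> R) u v : multilinear f ->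
  f (update u v 0) = 0.
Proof. by move=> fl; have := fl u v (-1) 0 0; rewrite scaler0 addr0 mulN1r addNr. Qed.

Lemma multilinearZ (I : eqType) (f : (I -> U) -> R) u v a h : multilinear f ->
  f (update u v (a *: h)) = a * f (update u v h).
Proof. by move=> fl; rewrite -[a *: h]addr0 fl multilinear0// addr0. Qed.

Lemma multilinearB (I : eqType) (f : (I -> U) -> R) u v h k : multilinear f ->
  f (update u v (h - k)) = f (update u v h) - f (update u v k).
Proof. by move=> fl; rewrite -[- k]scaleN1r multilinearD// multilinearZ// mulN1r. Qed.

Lemma multilinear_sum (I : eqType) (L : finType) (f : (I -> U) -> R) u v (a : L -> R) e :
  multilinear f ->
  f (update u v (\sum_l a l *: e l)) = \sum_l a l * f (update u v (e l)).
Proof.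
move=> fl; rewrite (big_morph (fun h => f (update u v h)) (id1 := 0) (op1 := +%R)).
- by apply: eq_bigr => l _; rewrite multilinearZ.
- by move=> h k; rewrite multilinearD.
- by rewrite multilinear0.
Qed.

Definition tcons n (h : U) (u : 'I_n -> U) : 'I_n.+1 -> U :=
  fun i => if unlift ord0 i is Some j then u j else h.

Lemma tcons_eta n (u : 'I_n.+1 -> U) : tcons (u ord0) (fun i => u (lift ord0 i)) = u.
Proof.
apply/funext => i; rewrite /tcons; case: (unliftP ord0 i) => [j ->|->]//.
Qed.

Lemma multilinear_expand n (L : finType) (f : ('I_n -> U) -> R)
    (a : 'I_n -> L -> R) (e : 'I_n -> L -> U) :
  multilinear f ->
  f (fun i => \sum_l a i l *: e i l) =
  \sum_(r : {ffun 'I_n -> L}) (\prod_i a i (r i)) * f (fun i => e i (r i)).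
Proof.
elim: n f a e => [|n IHn] f a e fl.
  case: (pickP L) => [l _|L0].
    rewrite (big_ffun0 _ [ffun => l]) big_ord0 mul1r; congr f.
    by apply/funext => -[].
  have w : {ffun 'I_0 -> L} by apply: finfun => -[].
  by rewrite (big_ffun0 _ w) big_ord0 mul1r; congr f; apply/funext => -[].
pose ft h u := f (tcons h u).
have ft_update h k u : ft h u = f (update (tcons k u) ord0 h).
  congr f; apply/funext => i; rewrite /update /tcons.
  by case: unliftP => [j ->|->]//; rewrite eqxx.
have ftl h : multilinear (ft h).
  move=> u v b k k'.
  have E w : tcons h (update u v w) = update (tcons h u) (lift ord0 v) w.
    apply/funext => i; rewrite /update /tcons; case: unliftP => [j ->|->].
      by rewrite (inj_eq lift_inj).
    by rewrite (negPf (neq_lift _ _)).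
  by rewrite /ft !E fl.
rewrite big_ffunS -[X in f X]tcons_eta -/(ft _ _) (ft_update _ 0) multilinear_sum//.
apply: eq_bigr => l _; rewrite -ft_update IHn// big_distrr/=.
apply: eq_bigr => w _; rewrite big_ord_recl fcons0 mulrA; congr (_ * _ * _).
  by apply: eq_bigr => i _; rewrite fconsS.
rewrite /ft; congr f; rewrite -[RHS]tcons_eta fcons0; congr tcons.
by apply/funext => i; rewrite fconsS.
Qed.

End Multilinear.

Section MultilinearCurves.
Context {R : realType} {d m : nat}.
Notation X := (vfield R d).
Context (f : ('I_m -> X) -> R).
Hypothesis f_multilinear : multilinear f.
Hypothesis f_continuous : forall (u : R -> 'I_m -> X) v,
  (forall i, u t i @[t --> (0 : R)^'] --> v i) -> f (u t) @[t --> (0 : R)^'] --> f v.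

(** Leibniz rule: the increment telescopes along the hybrids hyb k, whose first k
    slots have already moved; only continuity of f along curves is used. *)
Lemma is_derive_multilinear (c c' : 'I_m -> R -> X) (mu : R) :
  (forall i, r^-1 *: (c i (mu + r) - c i mu) @[r --> (0 : R)^'] --> c' i mu) ->
  is_derive mu 1 (fun mu => f (fun i => c i mu))
    (\sum_v f (update (fun i => c i mu) v (c' v mu))).
Proof.
move=> cc'.
have c_cont i : c i (mu + r) @[r --> (0 : R)^'] --> c i mu.
  have : (r *: (r^-1 *: (c i (mu + r) - c i mu)) + c i mu) @[r --> (0 : R)^'] --> 0 *: c' i mu + c i mu.
    apply: vfield_cvgD; last exact: cvg_cst.
    by apply: vfield_cvgZ; [exact: nbhs_dnbhs|exact: cc'].
  rewrite scale0r add0r; apply: cvg_trans; apply: near_eq_cvg; near=> r.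
  have r0 : r != 0 by near: r; exact: nbhs_dnbhs_neq.
  by rewrite scalerA divff// scale1r subrK.
pose hyb (k : nat) r (i : 'I_m) := if (i < k)%N then c i (mu + r) else c i mu.
pose q (v : 'I_m) r := f (update (hyb v r) v (r^-1 *: (c v (mu + r) - c v mu))).
have qE r : r^-1 * (f (fun i => c i (mu + r)) - f (fun i => c i mu)) = \sum_v q v r.
  have -> : (fun i => c i (mu + r)) = hyb m r.
    by apply/funext => i; rewrite /hyb ltn_ord.
  have -> : (fun i => c i mu) = hyb 0 r by [].
  rewrite -(telescope_sumr (fun k => f (hyb k r)))// big_mkord big_distrr/=.
  apply: eq_bigr => v _; rewrite /q multilinearZ//; congr (_ * _).
  rewrite multilinearB//; congr (f _ - f _); apply/funext => i;
    rewrite /update /hyb; case: eqP => [->|/eqP iv]; rewrite ?ltnSn ?ltnn//.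
  by rewrite ltnS leq_eqVlt -[_ == _ :> nat]/(i == v) (negPf iv).
have H : (\sum_v q v r) @[r --> (0 : R)^'] --> \sum_v f (update (fun i => c i mu) v (c' v mu)).
  have Hq v : q v r @[r --> (0 : R)^'] --> f (update (fun i => c i mu) v (c' v mu)).
    apply: f_continuous => i; rewrite /update; case: (i =P v) => [_|_]; first exact: cc'.
    by rewrite /hyb; case: (i < v)%N; [exact: c_cont|exact: cvg_cst].
  elim: (index_enum _) => [|v s IHs].
    rewrite big_nil; under eq_fun do rewrite big_nil; exact: cvg_cst.
  rewrite big_cons; under eq_fun do rewrite big_cons; exact: cvgD.
have E : (fun h : R => h^-1 *: (((fun mu => f (fun i => c i mu)) \o shift mu) (h *: 1) -
     f (fun i => c i mu))) = (fun r => \sum_v q v r).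
  by apply/funext => r; rewrite -qE /= [r *: 1]mulr1 [r + mu]addrC.
apply: DeriveDef; rewrite /derivable/derive E; first by apply: (cvgP _ H).
exact: cvg_lim H.
Unshelve. all: by end_near.
Qed.

End MultilinearCurves.

(** * Equivariance and reduction to jets *)

Section Equivariance.
Context {R : realType} {d : nat} (phi : vfield R d -> vfield R d).
Hypothesis phi_smooth : frechet_smooth phi.
Hypothesis phi_equiv : affine_equivariant phi.
Notation X := (vfield R d).
Implicit Types (f h : X) (hs : seq X).

Lemma aff_act_lin (A : 'M[R]_d) b a f h :
  aff_act A b (a *: f + h) = a *: aff_act A b f + aff_act A b h.
Proof.
by apply: vfield_ext => x; rewrite vfieldD vfieldZ !aff_actE vfieldD vfieldZ mulmxDr scalemxAr.
Qed.

Lemma aff_act0 (A : 'M[R]_d) b : aff_act A b 0 = 0.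
Proof. by have := aff_act_lin A b (-1) 0 0; rewrite !scaleN1r !addNr. Qed.

Lemma fderive_at_equivariant (A : 'M[R]_d) b x j hs f : A \in unitmx ->
  fderive_at phi x j [seq aff_act A b h | h <- hs] (aff_act A b f) =
  \sum_k A j k * fderive_at phi (invmx A *m (x - b)) k hs f.
Proof.
move=> Au; elim: hs f j => [|h hs IHs] f j /=.
  by rewrite /fderive_at/= phi_equiv// aff_actE mxE.
have L := @fderive_at_cvg _ _ phi phi_smooth x j [seq aff_act A b h | h <- hs] (aff_act A b f) (aff_act A b h).
have L' k := @fderive_at_cvg _ _ phi phi_smooth (invmx A *m (x - b)) k hs f h.
rewrite -(cvg_lim _ L)//; apply: cvg_lim => //.
have E : (fun t => t^-1 * (fderive_at phi x j [seq aff_act A b h | h <- hs] (aff_act A b f + t *: aff_act A b h) -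
      fderive_at phi x j [seq aff_act A b h | h <- hs] (aff_act A b f))) =
   (fun t : R => \sum_k A j k * (t^-1 * (fderive_at phi (invmx A *m (x - b)) k hs (f + t *: h) -
      fderive_at phi (invmx A *m (x - b)) k hs f))).
  apply/funext => t; rewrite [aff_act A b f + _]addrC -aff_act_lin !IHs -sumrB big_distrr/=.
  by apply: eq_bigr => k _; rewrite -mulrBr mulrCA [t *: h + f]addrC.
rewrite E; elim: (index_enum _) => [|k s IHk].
  by rewrite big_nil; under eq_fun do rewrite big_nil; exact: cvg_cst.
rewrite big_cons; under eq_fun do rewrite big_cons.
by apply: cvgD => //; apply: cvgM; [exact: cvg_cst|exact: L'].
Qed.

(** All Taylor coefficients of phi are determined by their values at 0. *)
Lemma fderive_at_translate x j hs :
  fderive_at phi x j hs 0 = fderive_at phi 0 j [seq aff_act 1%:M (- x) h | h <- hs] 0.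
Proof.
rewrite -{2}(aff_act0 1%:M (- x)) fderive_at_equivariant ?unitmx1//.
rewrite (bigD1 j)//= big1 => [|k kj]; last by rewrite mxE eq_sym (negPf kj) mul0r.
by rewrite mxE eqxx mul1r addr0 invmx1 mul1mx opprK add0r.
Qed.

Section Polarized.
Variable n : nat.

Definition taylor_form (j : 'I_d) (u : 'I_n.+1 -> X) : R :=
  fderive_at phi 0 j [seq u i | i : 'I_n.+1] 0.

Lemma taylor_form_multilinear j : multilinear (taylor_form j).
Proof. exact: fderive_at_multilinear. Qed.

Lemma taylor_form_continuous j (u : R -> 'I_n.+1 -> X) v :
  (forall i, u t i @[t --> (0 : R)^'] --> v i) ->
  taylor_form j (u t) @[t --> (0 : R)^'] --> taylor_form j v.
Proof.
move=> uv; apply: (@fderive_at_continuous _ _ phi phi_smooth 0 j n.+1 R (0 : R)^' _ (fun=> 0) u 0 v) => //.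
exact: cvg_cst.
Qed.

Lemma taylor_form_equivariant (A : 'M[R]_d) j u : A \in unitmx ->
  taylor_form j (fun v => aff_act A 0 (u v)) = \sum_k A j k * taylor_form k u.
Proof.
move=> Au; rewrite /taylor_form.
have -> : [seq aff_act A 0 (u i) | i : 'I_n.+1] = [seq aff_act A 0 h | h <- [seq u i | i : 'I_n.+1]].
  by rewrite /image_mem -map_comp.
rewrite -{1}(aff_act0 A 0) fderive_at_equivariant//.
by rewrite subr0 mulmx0.
Qed.

(** The homothety of ratio 1 / mu sends f to (dilate mu f) / mu; the n + 1 slots
    contribute mu ^- n.+1 and the output mu ^- 1. *)
Lemma taylor_form_dilate j f mu :
  taylor_form j (fun=> dilate mu f) = mu ^+ n * taylor_form j (fun=> f).
Proof.
have nz nu : nu != 0 -> taylor_form j (fun=> dilate nu f) = nu ^+ n * taylor_form j (fun=> f).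
  move=> nu0.
  have Au : (nu^-1)%:M \in @unitmx R d.
    by rewrite unitmxE det_scalar unitfE expf_neq0// invr_eq0.
  have actE : aff_act (nu^-1)%:M 0 f = nu^-1 *: dilate nu f.
    apply: vfield_ext => x; rewrite vfieldZ aff_actE subr0 invmx_scalar invrK.
    by rewrite !mul_scalar_mx.
  have := taylor_form_equivariant j (fun=> f) Au.
  rewrite actE (bigD1 j)//= big1 => [|k kj]; last by rewrite mxE eq_sym (negPf kj) mul0r.
  rewrite mxE eqxx mulr1n addr0 => E.
  have := @multilinear_expand R X n.+1 unit (taylor_form j) (fun _ _ => nu^-1)
    (fun _ _ => dilate nu f) (taylor_form_multilinear j).
  rewrite (bigD1 [ffun => tt])//= [X in _ = _ + X]big1 ?addr0 => [|w wN]; last first.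
    by move/eqP: wN; case; apply/ffunP => i; rewrite ffunE; case: (w i).
  rewrite (_ : (fun=> \sum_(l : unit) _) = (fun=> nu^-1 *: dilate nu f)); last first.
    by apply/funext => i; rewrite (bigD1 tt)//= big1 ?addr0// => -[].
  rewrite E prodr_const card_ord exprS -mulrA => /(mulfI (_ : nu^-1 != 0)).
  rewrite invr_eq0 => /(_ nu0) ->.
  by rewrite mulrA exprVn divff ?mul1r// expf_neq0.
(* Both sides are continuous in mu and agree off 0. *)
have [->|/nz//] := eqVneq mu 0.
have L1 : taylor_form j (fun=> dilate t f) @[t --> (0 : R)^'] --> taylor_form j (fun=> dilate 0 f).
  apply: taylor_form_continuous => _.
  have : (t *: (t^-1 *: (dilate (0 + t) f - dilate 0 f)) + dilate 0 f) @[t --> (0 : R)^'] -->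
      0 *: euler_dilate 0 f + dilate 0 f.
    apply: vfield_cvgD; last exact: cvg_cst.
    by apply: vfield_cvgZ; [exact: nbhs_dnbhs|exact: dilate_cvg].
  rewrite scale0r add0r; apply: cvg_trans; apply: near_eq_cvg; near=> t.
  have t0 : t != 0 by near: t; exact: nbhs_dnbhs_neq.
  by rewrite scalerA divff// scale1r add0r subrK.
have L2 : t ^+ n * taylor_form j (fun=> f) @[t --> (0 : R)^'] --> 0 ^+ n * taylor_form j (fun=> f).
  apply: cvgM; last exact: cvg_cst.
  by apply: (@continuous_cvg _ _ _ _ _ id (fun t : R => t ^+ n)); [exact: exprn_continuous|exact: nbhs_dnbhs].
rewrite -(cvg_lim _ L1)//; apply: cvg_lim => //.
apply: cvg_trans L2; apply: near_eq_cvg; near=> t; apply/esym/nz.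
by near: t; exact: nbhs_dnbhs_neq.
Unshelve. all: by end_near.
Qed.

Definition monomial (s : seq 'I_d) f : X :=
  foldr (fun l g => form_mul (delta_mx ord0 l) g) f s.

Lemma monomial_lin s a f h : monomial s (a *: f + h) = a *: monomial s f + monomial s h.
Proof. by elim: s => //= l s ->; rewrite form_mul_linr. Qed.

Lemma monomialB s f h : monomial s (f - h) = monomial s f - monomial s h.
Proof. by rewrite addrC -scaleN1r monomial_lin scaleN1r addrC. Qed.

Lemma monomial0 s : monomial s 0 = 0.
Proof. by rewrite -[0 in LHS](subrr 0) monomialB subrr. Qed.

Lemma monomialZ s a f : monomial s (a *: f) = a *: monomial s f.
Proof. by rewrite -[a *: f]addr0 monomial_lin monomial0 addr0. Qed.

Lemma monomial_cvg s (T : Type) (F : set_system T) (FF : Filter F) (g : T -> X) l :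
  g t @[t --> F] --> l -> monomial s (g t) @[t --> F] --> monomial s l.
Proof. by move=> gl; elim: s => //= i s; exact: vfield_cvg_form_mul. Qed.

Lemma monomial_rcons s l f : monomial (rcons s l) f = monomial s (form_mul (delta_mx ord0 l) f).
Proof. by rewrite /monomial foldr_rcons. Qed.

Lemma partials_rcons s l f : partials (rcons s l) f = partial l (partials s f).
Proof. by rewrite /partials foldl_rcons. Qed.

(** This family of curves is stable under differentiation: d/dmu appends one
    letter to s, both to the monomial and to the derivative of f. *)
Definition jet_curve f (s : seq 'I_d) mu : X := monomial s (dilate mu (partials s f)).

Lemma jet_curve_cvg f s mu :
  r^-1 *: (jet_curve f s (mu + r) - jet_curve f s mu) @[r --> (0 : R)^'] -->
  \sum_l jet_curve f (rcons s l) mu.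
Proof.
have -> : \sum_l jet_curve f (rcons s l) mu = monomial s (euler_dilate mu (partials s f)).
  rewrite /euler_dilate (big_morph (monomial s) (id1 := 0) (op1 := +%R)).
  - by apply: eq_bigr => l _; rewrite /jet_curve monomial_rcons partials_rcons.
  - by move=> g h; rewrite -[g]scale1r monomial_lin !scale1r.
  - exact: monomial0.
under eq_fun do rewrite /jet_curve -monomialB -monomialZ.
by apply: monomial_cvg; exact: dilate_cvg.
Qed.

Definition jet_term j f (S : 'I_n.+1 -> seq 'I_d) (mu : R) : R :=
  taylor_form j (fun v => jet_curve f (S v) mu).

Definition push_letter (S : 'I_n.+1 -> seq 'I_d) (p : 'I_n.+1 * 'I_d) : 'I_n.+1 -> seq 'I_d :=
  update S p.1 (rcons (S p.1) p.2).

Lemma is_derive_jet_term j f S (mu : R) :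
  is_derive mu 1 (jet_term j f S) (\sum_p jet_term j f (push_letter S p) mu).
Proof.
have tf_cont := @taylor_form_continuous j.
have H := @is_derive_multilinear R d n.+1 _ (taylor_form_multilinear j) tf_cont
  (fun i => jet_curve f (S i)) (fun i mu => \sum_l jet_curve f (rcons (S i) l) mu) mu
  (fun i => @jet_curve_cvg f (S i) mu).
apply: is_derive_eq H _.
rewrite -(pair_bigA _ (fun v l => jet_term j f (push_letter S (v, l)) mu))/=.
apply: eq_bigr => v _.
have -> : \sum_l jet_curve f (rcons (S v) l) mu = \sum_l 1 *: jet_curve f (rcons (S v) l) mu.
  by apply: eq_bigr => l _; rewrite scale1r.
rewrite multilinear_sum; last exact: taylor_form_multilinear.
apply: eq_bigr => l _; rewrite mul1r /jet_term; congr taylor_form.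
by apply/funext => i; rewrite /update/push_letter/update/=; case: eqP.
Qed.

Definition push_word k (S : 'I_n.+1 -> seq 'I_d) (w : {ffun 'I_k -> 'I_n.+1 * 'I_d}) :
    'I_n.+1 -> seq 'I_d :=
  fun v => S v ++ [seq (w a).2 | a <- enum 'I_k & (w a).1 == v].

Lemma push_word_fcons k S p (w : {ffun 'I_k -> 'I_n.+1 * 'I_d}) :
  push_word S (fcons p w) = push_word (push_letter S p) w.
Proof.
apply/funext => v; rewrite /push_word enum_ordSl /= fcons0 filter_map.
rewrite (eq_filter (a2 := fun a => (w a).1 == v)); last by move=> a /=; rewrite fconsS.
have E : [seq (fcons p w a).2 | a <- [seq lift ord0 i | i <- enum 'I_k & (w i).1 == v]] =
   [seq (w a).2 | a <- enum 'I_k & (w a).1 == v].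
  by rewrite -map_comp; apply: eq_map => a /=; rewrite fconsS.
rewrite /push_letter/update; have [->|pv] := eqVneq p.1 v.
  by rewrite /= cat_rcons fcons0 E.
by rewrite E.
Qed.

(** Comparing successive derivatives of both sides at mu = 0. Linear combinations
    indexed by J are needed for the induction, since a derivative of one term
    is a sum over the slot and direction hit. *)
Lemma iterated_derivative k (J : finType) (S : J -> 'I_n.+1 -> seq 'I_d) j f c :
  (forall mu, \sum_i jet_term j f (S i) mu = mu ^+ k * c) ->
  \sum_i \sum_(w : {ffun 'I_k -> 'I_n.+1 * 'I_d}) jet_term j f (push_word (S i) w) 0 = k`!%:R * c.
Proof.
elim: k J S c => [|k IHk] J S c H.
  rewrite fact0 -[RHS]/(0 ^+ 0 * c) -H; apply: eq_bigr => i _.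
  have w : {ffun 'I_0 -> 'I_n.+1 * 'I_d} by apply: finfun => -[].
  rewrite (big_ffun0 _ w); congr (jet_term _ _ _ _); apply/funext => v.
  by rewrite /push_word (size0nil (size_enum_ord 0)) cats0.
under eq_bigr => i _ do rewrite big_ffunS.
rewrite pair_bigA/=.
rewrite factS natrM [k.+1%:R * k`!%:R]mulrC -mulrA.
rewrite -(IHk _ (fun q => push_letter (S q.1) q.2)).
  by apply: eq_bigr => q _; apply: eq_bigr => w _; rewrite push_word_fcons.
move=> mu.
have D1 : is_derive mu 1 (fun mu : R => mu ^+ k.+1 * c) (\sum_i \sum_p jet_term j f (push_letter (S i) p) mu).
  rewrite -(_ : \sum_i jet_term j f (S i) = (fun mu : R => mu ^+ k.+1 * c)).
    elim/big_ind2: _ => [|? ? ? ? ? ?|i _]; first exact: is_derive_cst.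
      exact: is_deriveD.
    exact: is_derive_jet_term.
  by apply/funext => nu; rewrite fct_sumE H.
rewrite -(pair_bigA _ (fun i p => jet_term j f (push_letter (S i) p) mu))/=.
have D2 : is_derive mu 1 (fun mu : R => mu ^+ k.+1 * c) (mu ^+ k * (k.+1%:R * c)).
  have -> : (fun mu : R => mu ^+ k.+1 * c) = c \*: (id ^+ k.+1 : R -> R).
    by apply/funext => nu; rewrite mulrC exprfctE.
  apply: is_derive_eq; rewrite /= [_ *: 1]mulr1.
  by rewrite [LHS]mulrC [_ * mu ^+ k]mulrC -mulrA.
by rewrite -(derive_val (is_derive := D1)) -(derive_val (is_derive := D2)).
Qed.

(** The map w records, for each of the n derivatives, the slot that it hits and
    its direction. *)
Theorem taylor_form_jets j f :
  n`!%:R * taylor_form j (fun=> f) =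
  \sum_(w : {ffun 'I_n -> 'I_n.+1 * 'I_d})
    taylor_form j (fun v =>
      let s := [seq (w a).2 | a <- enum 'I_n & (w a).1 == v] in
      monomial s (cst_field (partials s f 0))).
Proof.
have H mu : \sum_(i : unit) jet_term j f (fun=> [::]) mu = mu ^+ n * taylor_form j (fun=> f).
  by rewrite (bigD1 tt)//= big1 ?addr0 => [|[]//]; exact: taylor_form_dilate.
rewrite -(@iterated_derivative n unit (fun _ _ => [::]) j f _ H).
rewrite (big_pred1 tt); last by case.
apply: eq_bigr => w _; congr taylor_form; apply/funext => v.
by congr monomial; apply: vfield_ext => x /=; rewrite scale0r.
Qed.

End Polarized.
End Equivariance.

(** * Equivariant coefficients are contractions *)

Section Tensor.
Context {R : realType} {d : nat} (phi : vfield R d -> vfield R d).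
Hypothesis phi_smooth : frechet_smooth phi.
Hypothesis phi_equiv : affine_equivariant phi.
Notation X := (vfield R d).
Variable n : nat.
Implicit Types (f h : X) (tau : {ffun 'I_n -> 'I_n.+1}) (xi : 'I_n -> 'rV[R]_d) (w : 'I_n.+1 -> 'cV[R]_d).

Definition forms_mul xi (r : seq 'I_n) f : X :=
  foldr (fun a g => form_mul (xi a) g) f r.

Lemma forms_mul_lin xi r a f h :
  forms_mul xi r (a *: f + h) = a *: forms_mul xi r f + forms_mul xi r h.
Proof. by elim: r => //= b r ->; rewrite form_mul_linr. Qed.

Lemma forms_mul_update xi r a0 z f :
  a0 \notin r -> forms_mul (update xi a0 z) r f = forms_mul xi r f.
Proof.
elim: r => //= b r IHr; rewrite inE negb_or => /andP[ab ar].
by rewrite IHr// /update eq_sym (negPf ab).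
Qed.

Lemma forms_mul_lin_form xi r a0 c y z f : uniq r -> a0 \in r ->
  forms_mul (update xi a0 (c *: y + z)) r f =
  c *: forms_mul (update xi a0 y) r f + forms_mul (update xi a0 z) r f.
Proof.
elim: r => //= b r IHr /andP[br ur]; rewrite inE => /orP[/eqP ab|ar].
  by rewrite -ab in br *; rewrite !forms_mul_update// /update eqxx form_mul_linl.
have ba : b != a0 by apply: contraNneq br => ->.
by rewrite IHr// /update (negPf ba) form_mul_linr.
Qed.

Definition arrows_into tau (v : 'I_n.+1) : seq 'I_n := [seq a <- enum 'I_n | tau a == v].

(** The Taylor form on fields that are products of linear forms times a constant
    vector. It is multilinear in the forms and in the vectors, and tau tells
    which field each form multiplies. *)
Definition theta (j : 'I_d) tau xi w : R :=
  taylor_form phi j (fun v => forms_mul xi (arrows_into tau v) (cst_field (w v))).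

Lemma cst_field_lin a (u v : 'cV[R]_d) :
  cst_field (a *: u + v) = a *: cst_field u + cst_field v :> X.
Proof. exact: vfield_ext. Qed.

Lemma theta_multilinear_vectors j tau xi : multilinear (theta j tau xi).
Proof.
move=> w v a h k; rewrite /theta.
have E u : (fun v' => forms_mul xi (arrows_into tau v') (cst_field (update w v u v'))) =
    update (fun v' => forms_mul xi (arrows_into tau v') (cst_field (w v'))) v
      (forms_mul xi (arrows_into tau v) (cst_field u)).
  by apply/funext => v'; rewrite /update; case: (v' =P v) => [->|].
by rewrite !E cst_field_lin forms_mul_lin taylor_form_multilinear.
Qed.

Lemma theta_multilinear_forms j tau w : multilinear (fun xi => theta j tau xi w).
Proof.
move=> xi a0 c y z; rewrite /theta.
have E u : (fun v => forms_mul (update xi a0 u) (arrows_into tau v) (cst_field (w v))) =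
    update (fun v => forms_mul xi (arrows_into tau v) (cst_field (w v))) (tau a0)
      (forms_mul (update xi a0 u) (arrows_into tau (tau a0)) (cst_field (w (tau a0)))).
  apply/funext => v; rewrite {2}/update; case: (v =P tau a0) => [->//|vt].
  by rewrite forms_mul_update// mem_filter; apply/negP => /andP[/eqP/esym].
rewrite !E forms_mul_lin_form ?taylor_form_multilinear//.
  by rewrite filter_uniq// enum_uniq.
by rewrite mem_filter eqxx mem_enum.
Qed.

Lemma aff_act_form_mul (A : 'M[R]_d) (z : 'rV[R]_d) f :
  aff_act A 0 (form_mul z f) = form_mul (z *m invmx A) (aff_act A 0 f).
Proof.
apply: vfield_ext => x; rewrite aff_actE !form_mulE aff_actE subr0.
by rewrite -scalemxAr mulmxA.
Qed.

Lemma theta_equivariant (A : 'M[R]_d) j tau xi w : A \in unitmx ->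
  theta j tau (fun a => xi a *m invmx A) (fun v => A *m w v) =
  \sum_k A j k * theta k tau xi w.
Proof.
move=> Au; rewrite -(taylor_form_equivariant phi_smooth phi_equiv _ _ Au).
rewrite /theta; congr taylor_form; apply/funext => v.
elim: (arrows_into tau v) => [|a r IHr] /=; last by rewrite aff_act_form_mul IHr.
by apply: vfield_ext => x; rewrite aff_actE.
Qed.

(** Index 0 of K is the output component; the others are the directions of the
    n arrows. In this way the output is on a par with the arrows. *)
Definition coefficient tau (K L : {ffun 'I_n.+1 -> 'I_d}) : R :=
  theta (K ord0) tau (fun a => delta_mx ord0 (K (lift ord0 a)))
    (fun v => delta_mx (L v) ord0).

Lemma col_delta_expand (w : 'cV[R]_d) : w = \sum_l w l ord0 *: delta_mx l ord0.
Proof. by rewrite {1}(matrix_sum_delta w); apply: eq_bigr => l _; rewrite big_ord1. Qed.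

Lemma row_delta_expand (z : 'rV[R]_d) : z = \sum_l z ord0 l *: delta_mx ord0 l.
Proof. by rewrite {1}(matrix_sum_delta z) big_ord1. Qed.

Lemma theta_expand j tau (J : {ffun 'I_n -> 'I_d}) w :
  theta j tau (fun a => delta_mx ord0 (J a)) w =
  \sum_(L : {ffun 'I_n.+1 -> 'I_d}) (\prod_v w v (L v) ord0) * coefficient tau (fcons j J) L.
Proof.
rewrite [X in theta _ _ _ X](_ : _ = fun v => \sum_l w v l ord0 *: delta_mx l ord0); last first.
  by apply/funext => v; rewrite -col_delta_expand.
rewrite (@multilinear_expand R 'cV[R]_d n.+1 _ (theta j tau _)); last exact: theta_multilinear_vectors.
apply: eq_bigr => L _; congr (_ * _); rewrite /coefficient fcons0; congr (theta _ _ _ _).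
by apply/funext => a; rewrite fconsS.
Qed.

(** Apply equivariance to the forms (A x)_{J a} and basis vectors: A turns the
    forms into coordinates and the basis vectors into columns of A, and
    expanding both sides gives the two products. *)
Lemma coefficient_comm tau (A : 'M[R]_d) : A \in unitmx ->
  kernel_comm (tensor_power A) (coefficient tau).
Proof.
move=> Au K L; rewrite -(fcons_eta K); move: (K ord0) [ffun i => _] => j J {K}.
transitivity (theta j tau (fun a => delta_mx ord0 (J a)) (fun v => A *m delta_mx (L v) ord0)); last first.
  rewrite theta_expand; apply: eq_bigr => P _; rewrite mulrC; congr (_ * _).
  by apply: eq_bigr => v _; rewrite -colE mxE.
rewrite [X in theta _ _ X _](_ : _ = fun a => row (J a) A *m invmx A); last first.
  by apply/funext => a; rewrite -row_mul mulmxV// rowE mulmx1.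
rewrite theta_equivariant// big_ffunS; apply: eq_bigr => k _.
rewrite [X in theta _ _ X _](_ : _ = fun a => \sum_l A (J a) l *: delta_mx ord0 l); last first.
  apply/funext => a; rewrite [LHS]row_delta_expand.
  by apply: eq_bigr => l _; rewrite mxE.
rewrite (@multilinear_expand R 'rV[R]_d n _ (fun xi => theta k tau xi _)); last exact: theta_multilinear_forms.
rewrite big_distrr/=; apply: eq_bigr => P _; rewrite mulrA; congr (_ * _).
  rewrite /tensor_power big_ord_recl !fcons0; congr (_ * _).
  by apply: eq_bigr => a _; rewrite !fconsS.
rewrite /coefficient fcons0; congr (theta _ _ _ _).
by apply/funext => a; rewrite fconsS.
Qed.

Lemma taylor_form_contractions : exists c : {ffun 'I_n -> 'I_n.+1} -> {perm 'I_n.+1} -> R,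
  forall f j, n`!%:R * taylor_form phi j (fun _ : 'I_n.+1 => f) =
  \sum_tau \sum_s c tau s *
    \sum_(i : {ffun 'I_n.+1 -> 'I_d} | i (s ord0) == j)
      \prod_v partials [seq i (s (lift ord0 a)) | a <- arrows_into tau v] f 0 (i v) ord0.
Proof.
have /choice[c cE] tau := first_fundamental_theorem (coefficient_comm tau).
exists c => f j; rewrite taylor_form_jets//.
transitivity (\sum_tau \sum_(J : {ffun 'I_n -> 'I_d})
   theta j tau (fun a => delta_mx ord0 (J a)) (fun v => partials [seq J a | a <- arrows_into tau v] f 0)).
  rewrite pair_bigA/= (reindex (fun p : {ffun 'I_n -> 'I_n.+1} * {ffun 'I_n -> 'I_d} => [ffun a => (p.1 a, p.2 a)]))/=.
    apply: eq_bigr => -[tau J] _ /=; rewrite /theta; congr taylor_form; apply/funext => v.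
    rewrite (eq_filter (a2 := fun a => tau a == v)); last by move=> a; rewrite ffunE.
    rewrite (eq_map (g := J)); last by move=> a; rewrite ffunE.
    rewrite -/(arrows_into tau v); elim: (arrows_into tau v) (cst_field _) => //= a r IHr g.
    by rewrite /monomial/= -/(monomial _ _) IHr.
  exists (fun w : {ffun 'I_n -> 'I_n.+1 * 'I_d} => ([ffun a => (w a).1], [ffun a => (w a).2])).
    by move=> [tau J] _; congr (_, _); apply/ffunP => a; rewrite !ffunE.
  by move=> w _; apply/ffunP => a; rewrite !ffunE; case: (w a).
apply: eq_bigr => tau _.
under eq_bigr => J _ do rewrite theta_expand.
rewrite exchange_big/=.
transitivity (\sum_(i : {ffun 'I_n.+1 -> 'I_d}) \sum_s c tau s * ((i (s ord0) == j)%:R *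
   \prod_v partials [seq i (s (lift ord0 a)) | a <- arrows_into tau v] f 0 (i v) ord0)).
  apply: eq_bigr => i _; under eq_bigr => J _ do rewrite cE big_distrr/=.
  rewrite exchange_big/=; apply: eq_bigr => s _.
  pose J0 : {ffun 'I_n -> 'I_d} := [ffun a => i (s (lift ord0 a))].
  have EJ J : (fcons j J == permute i s) = (i (s ord0) == j) && (J == J0).
    apply/eqP/andP => [E|[/eqP <- /eqP ->]].
      split; first by have := congr1 (fun g : {ffun _ -> _} => g ord0) E; rewrite fcons0 ffunE => ->.
      apply/eqP/ffunP => a; have := congr1 (fun g : {ffun _ -> _} => g (lift ord0 a)) E.
      by rewrite fconsS !ffunE.
    rewrite -[RHS]fcons_eta ffunE; congr fcons.
    by apply/ffunP => a; rewrite !ffunE.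
  rewrite (bigD1 J0)//= [X in _ + X]big1 ?addr0 => [|J JN]; last by rewrite EJ (negPf JN) andbF !mulr0.
  rewrite EJ eqxx andbT mulrCA; congr (_ * _); rewrite mulrC; congr (_ * _).
  apply: eq_bigr => v _; congr (partials _ f 0 _ _).
  by apply: eq_map => a; rewrite ffunE.
rewrite exchange_big/=; apply: eq_bigr => s _; rewrite -big_distrr/=; congr (_ * _).
rewrite [RHS]big_mkcond/=; apply: eq_bigr => i _.
by case: ifP => _; rewrite ?mul1r ?mul0r.
Qed.

End Tensor.

(** * Elementary differentials *)

Section ElementaryDifferentials.
Context {R : realType} {d : nat}.
Notation X := (vfield R d).
Implicit Types (f : X).

Lemma partials_perm (s t : seq 'I_d) f : perm_eq s t -> partials s f = partials t f.
Proof.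
move=> st.
have single_comm i s2 h : partials s2 (partial i h) = partial i (partials s2 h).
  by elim: s2 h => //= k s2 IHs2 h; rewrite partial_comm IHs2.
have cat_comm s1 s2 h : partials s1 (partials s2 h) = partials s2 (partials s1 h).
  by elim: s1 h => //= i s1 IHs h; rewrite -single_comm IHs.
apply: (catCA_perm_ind (P := fun r => partials s f = partials r f)) st _ => // s1 s2 s3 ->.
by rewrite /partials !foldl_cat -!/(partials _ _) [partials s2 _]cat_comm.
Qed.

Lemma partials_coord s f x j : pderive s (fun y => f y j ord0) x = partials s f x j ord0.
Proof.
suff -> : pderive s (fun y => f y j ord0) = (fun y => partials s f y j ord0) by [].
elim: s f => //= i s IHs f; rewrite -IHs; congr pderive.
by apply/funext => y; rewrite -(derive_coord j (delta_mx i ord0) y (vfieldP f)).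
Qed.

Lemma partials_translate s f x :
  partials s (aff_act 1%:M (- x) f) = aff_act 1%:M (- x) (partials s f).
Proof.
elim: s f => //= i s IHs f; rewrite -IHs; congr partials.
apply: vfield_ext => y; rewrite aff_actE /= invmx1 !mul1mx.
apply: (congr1 (fun u : R -> 'cV[R]_d => lim (u h @[h --> 0^']))); apply/funext => h /=.
by rewrite !mul1mx !opprK addrA.
Qed.

Lemma elem_diff_funE n (g : forest n.+1 n) f x j :
  elem_diff_fun g f x j ord0 =
  \sum_(i : {ffun 'I_n.+1 -> 'I_d} | i (Defs.root g) == j)
    \prod_v partials [seq i (src g a) | a <- enum 'I_n & tgt g a == v] f x (i v) ord0.
Proof.
rewrite mxE; apply: eq_bigr => i _; apply: eq_bigr => v _.
by rewrite partials_coord.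
Qed.

Lemma elem_diff_fun_translate n (g : forest n.+1 n) f x :
  elem_diff_fun g f x = elem_diff_fun g (aff_act 1%:M (- x) f) 0.
Proof.
apply/matrixP => j k; rewrite (ord1 k) !elem_diff_funE.
apply: eq_bigr => i _; apply: eq_bigr => v _.
by rewrite partials_translate aff_actE invmx1 !mul1mx opprK add0r.
Qed.

Lemma elem_diff_fun_iso n (g g' : forest n.+1 n) f : forest_iso g g' ->
  elem_diff_fun g f = elem_diff_fun g' f.
Proof.
move=> /forest_isoP[p [q pq]]; apply/funext => x; apply/matrixP => j k.
have rootE : Defs.root g' = p (Defs.root g).
  apply/eqP; rewrite eq_sym Defs.rootP; apply/negP => /codomP[b].
  rewrite -[b](permKV q) (pq _).1 => /perm_inj E.
  have := Defs.rootP g (Defs.root g); rewrite eqxx => /esym/negP; apply.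
  by rewrite E codom_f.
rewrite (ord1 k) !elem_diff_funE.
rewrite (reindex (fun i : {ffun 'I_n.+1 -> 'I_d} => [ffun v => i (p v)])); last first.
  exists (fun i : {ffun 'I_n.+1 -> 'I_d} => [ffun v => i (p^-1%g v)]) => i _; apply/ffunP => v; rewrite !ffunE.
    by rewrite permKV.
  by rewrite permK.
apply: eq_big => [i|i _]; first by rewrite ffunE rootE.
rewrite [RHS](reindex_inj (@perm_inj _ p)); apply: eq_bigr => v _; rewrite ffunE.
congr (vfield_fun _ x _ _); apply: partials_perm.
have -> : [seq [ffun v => i (p v)] (src g a) | a <- enum 'I_n & tgt g a == v] =
    [seq i (src g' b) | b <- [seq q a | a <- enum 'I_n] & tgt g' b == p v].
  rewrite [in RHS]filter_map -[RHS]map_comp.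
  rewrite [in RHS](eq_filter (a2 := fun a => tgt g a == v)).
    by apply: eq_map => a /=; rewrite ffunE (pq a).1.
  by move=> a /=; rewrite (pq a).2 (inj_eq perm_inj).
apply: perm_map; apply: perm_filter; apply: uniq_perm; rewrite ?enum_uniq//.
  by rewrite map_inj_uniq ?enum_uniq//; exact: perm_inj.
move=> b; rewrite mem_enum; apply/mapP; exists (q^-1%g b); rewrite ?mem_enum//.
by rewrite permKV.
Qed.

Section ForestOfPermutation.
Context {n : nat} (tau : {ffun 'I_n -> 'I_n.+1}) (s : {perm 'I_n.+1}).

Fact perm_source_inj : injectiveb ([ffun a : 'I_n => s (lift ord0 a)]).
Proof. by apply/injectiveP => a b; rewrite !ffunE => /perm_inj/lift_inj. Qed.

(** The contraction pattern s read as a graph: arrow a leaves the node whose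
    component is contracted with its direction, and the free node s ord0 is the
    root. *)
Definition forest_of_perm : forest n.+1 n :=
  exist (fun st : {ffun 'I_n -> 'I_n.+1} * {ffun 'I_n -> 'I_n.+1} => injectiveb st.1)
    ([ffun a : 'I_n => s (lift ord0 a)], tau) perm_source_inj.

Lemma root_forest_of_perm : Defs.root forest_of_perm = s ord0.
Proof.
apply/eqP; rewrite eq_sym Defs.rootP; apply/negP => /codomP[a].
by rewrite /src/= ffunE => /perm_inj/eqP; rewrite (negPf (neq_lift _ _)).
Qed.

Lemma elem_diff_forest_of_perm f j :
  elem_diff_fun forest_of_perm f 0 j ord0 =
  \sum_(i : {ffun 'I_n.+1 -> 'I_d} | i (s ord0) == j)
    \prod_v partials [seq i (s (lift ord0 a)) | a <- arrows_into tau v] f 0 (i v) ord0.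
Proof.
rewrite elem_diff_funE root_forest_of_perm; apply: eq_bigr => i _; apply: eq_bigr => v _.
congr (partials _ f 0 _ _); apply: eq_map => a.
by rewrite /src ffunE.
Qed.

End ForestOfPermutation.

(** Grouping by isomorphism class; the chosen representative of a class may be
    replaced by any member. *)
Lemma sum_forest_classes n (J : finType) (g : J -> forest n.+1 n) (c : J -> R) f :
  \sum_(t : atree n) (\sum_(k | \pi_(atree n)%qT (g k) == t) c k) *: elem_diff t f =
  \sum_k c k *: VField (smooth_elem_diff (g k) f).
Proof.
rewrite [RHS](partition_big (fun k => \pi_(atree n)%qT (g k)) predT)//=.
apply: eq_bigr => t _; rewrite scaler_suml; apply: eq_bigr => k /eqP gt.
congr (_ *: _); apply: vfield_ext => x /=; congr (_ x).
by apply: elem_diff_fun_iso; apply/atreeP; rewrite reprK gt.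
Qed.

End ElementaryDifferentials.

(** * Taylor terms as aromatic series *)

Section TaylorTerms.
Context {R : realType} {d : nat} (phi : vfield R d -> vfield R d).
Notation X := (vfield R d).
Hypothesis phi_smooth : frechet_smooth phi.
Hypothesis phi_equiv : affine_equivariant phi.

Lemma taylor_term_abseries n : exists b : atree n -> R, forall f : X,
  taylor_term phi n.+1 f = \sum_t b t *: elem_diff t f.
Proof.
have [c cE] := taylor_form_contractions phi_smooth phi_equiv n.
pose J := ({ffun 'I_n -> 'I_n.+1} * {perm 'I_n.+1})%type.
pose a (k : J) : R := (n.+1`!%:R)^-1 * (n`!%:R^-1 * c k.1 k.2).
exists (fun t => \sum_(k : J | \pi_(atree n)%qT (forest_of_perm k.1 k.2) == t) a k) => f.
rewrite (sum_forest_classes (fun k : J => forest_of_perm k.1 k.2)).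
apply: vfield_ext => x; apply/matrixP => j l; rewrite (ord1 l).
rewrite vfieldZ vfield_sum summxE mxE.
have -> : fderive phi (nseq n.+1 f) 0 x j ord0 =
    taylor_form phi j (fun _ : 'I_n.+1 => aff_act 1%:M (- x) f).
  rewrite -[LHS]/(fderive_at phi x j _ 0) (fderive_at_translate phi_smooth phi_equiv).
  congr (fderive_at phi 0 j _ 0); rewrite map_nseq.
  rewrite /image_mem; apply: (@eq_from_nth _ 0); first by rewrite size_nseq size_map size_enum_ord.
  move=> i; rewrite size_nseq => im; rewrite nth_nseq im (nth_map ord0) ?size_enum_ord//.
have nN0 : n`!%:R != 0 :> R by rewrite pnatr_eq0 -lt0n fact_gt0.
rewrite -[taylor_form _ _ _](mulKf nN0) cE pair_bigA/= !big_distrr/=.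
apply: eq_bigr => k _.
rewrite -[RHS]/((a k *: elem_diff_fun (forest_of_perm k.1 k.2) f x) j ord0) mxE.
rewrite /a -!mulrA; congr (_ * (_ * (_ * _))).
by rewrite elem_diff_fun_translate elem_diff_forest_of_perm.
Qed.

End TaylorTerms.

Theorem theorem2p4 (R : realType) (d : nat) (phi : vfield R d -> vfield R d) :
  (1 <= d)%N ->
  frechet_smooth phi -> local_map phi -> affine_equivariant phi ->
  exists b : aromatic_tree -> R,
    forall (m : nat) (f : vfield R d),
      taylor_term phi m f = abseries_term b m f.
Proof.
move=> _ phi_smooth phi_local phi_equiv.
pose b n := projT1 (cid (taylor_term_abseries phi_smooth phi_equiv n)).
have bE n f : taylor_term phi n.+1 f = \sum_t b n t *: elem_diff t f.
  exact: projT2 (cid (taylor_term_abseries phi_smooth phi_equiv n)) f.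
exists (fun t => b (tag t) (tagged t)) => -[|n] f; last exact: bE.
(* Degree 0: by locality phi 0 has empty support. *)
rewrite /taylor_term /= invr1 scale1r; apply: vfield_ext => x; apply/eqP.
apply: contraT => phi0x.
have := phi_local 0 x (@subset_closure _ [set y | phi 0 y != 0] x phi0x).
rewrite /supp (_ : [set y | _] = set0) ?closure0//.
by apply/seteqP; split=> // y /=; rewrite eqxx.
Qed.
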